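(* Let $\Delta$ be an irreducible root system whose highest root $\theta$ is fundamental (i.e., $\Delta$ is not of type $A_n$ or $C_n$). Let $\Pi$ be the set of simple roots, $\Pi_l$ the set of long simple roots, and let $\mathcal A_{\mathcal H}=\mathcal A\cap\mathcal H$ be the set of amazing roots that are not orthogonal to $\theta$. Then: (i) $\#\mathcal A_{\mathcal H}=\#\Pi_l+1$; (ii) $\mathcal A_{\mathcal H}$ is a subposet of $\Delta^+$ and its Hasse diagram is a tree that is isomorphic to the sub-diagram of the extended Dynkin diagram of $\Delta$, where the nodes corresponding to the short roots are omitted; there is a natural bijection between the edges of the tree $\mathcal A_{\mathcal H}$ and $\Pi_l$; (iii) in the non-simply laced cases $B_n$, $F_4$, and $G_2$, one can add to $\mathcal A_{\mathcal H}$ some short commutative roots so that the resulting subposet, say $\widetilde{\mathcal A_{\mathcal H}}$, represents the whole extended Dynkin diagram; there is a natural bijection between the edges of the tree $\widetilde{\mathcal A_{\mathcal H}}$ and $\Pi$; (iv) in all cases, the vertex $\theta\in\mathcal A_{\mathcal H}$ represents the extra node of the extended Dynkin diagram.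
   Context: Let $\Delta$ be an irreducible (reduced, crystallographic) root system, the root system of a simple complex Lie algebra, with positive roots $\Delta^+$, simple roots $\Pi$, highest root $\theta$, and a Weyl-group-invariant inner product $(\ ,\ )$. ''$\theta$ is fundamental'' means that $\theta$ is a fundamental weight. $\Delta^+_l$ is the set of long positive roots (all roots are long in the simply-laced case). The partial order on $\Delta^+$: $\mu\preccurlyeq\nu$ if $\nu-\mu$ is a non-negative integral combination of simple roots. An upper ideal is a subset $I\subset\Delta^+$ such that $\nu\in I$, $\gamma\in\Delta^+$, $\nu\preccurlyeq\gamma$ imply $\gamma\in I$. An abelian ideal is an upper ideal $I$ with $\gamma'+\gamma''\notin\Delta^+$ for all $\gamma',\gamma''\in I$. For $\gamma\in\Delta^+$ put $I\langle\succcurlyeq\gamma\rangle=\{\nu\in\Delta^+\mid\nu\succcurlyeq\gamma\}$; $\gamma$ is commutative if $I\langle\succcurlyeq\gamma\rangle$ is abelian. Put $\mathcal H=\{\gamma\in\Delta^+\mid(\gamma,\theta)\ne0\}$. Subposets carry the induced order; the Hasse diagram of a finite poset is the graph of its covering relations. The extended Dynkin diagram of $\Delta$ is the Dynkin diagram with one extra node added, corresponding to $-\theta$. Rootlets. Let $V$ be the real span of $\Delta$ and consider $V\oplus\mathbb R\delta$. The real affine roots are $\gamma+k\delta$ ($\gamma\in\Delta$, $k\in\mathbb Z$); the positive ones $\widehat\Delta^+$ are those with $k\ge 1$, or $k=0$ and $\gamma\in\Delta^+$. The affine Weyl group $\widehat W$ is generated by the reflections $s_{\gamma+k\delta}$,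 acting by $s_{\gamma+k\delta}(\beta+m\delta)=s_\gamma(\beta)+(m-k\langle\beta,\gamma^\vee\rangle)\delta$ (so $\widehat W$ fixes $\delta$). For $w\in\widehat W$ let $N(w)=\{\nu\in\widehat\Delta^+\mid w(\nu)\in-\widehat\Delta^+\}$. It is known (Peterson) that for each abelian ideal $I$ there is a unique $w_I\in\widehat W$ with $N(w_I)=\{\delta-\gamma\mid\gamma\in I\}$. For a nonempty abelian ideal $I$, its rootlet is $\mathrm{rt}(I)=w_I(2\delta-\theta)$; it is known to be an element of $\Delta^+_l$, and every element of $\Delta^+_l$ is the rootlet of some nonempty abelian ideal. For $\mu\in\Delta^+_l$, the set of nonempty abelian ideals with rootlet $\mu$, ordered by inclusion, is known to have a unique maximal element, denoted $I(\mu)_{\max}$. A root $\gamma\in\Delta^+_l$ is amazing if $I(\gamma)_{\max}=I\langle\succcurlyeq\gamma\rangle$; $\mathcal A$ is the set of amazing roots. *)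

(* Defs.v *)
From HB Require Import structures.
From mathcomp Require Import all_boot all_order all_algebra.
From mathcomp Require Import finmap boolp.

Set Implicit Arguments.
Unset Strict Implicit.
Unset Printing Implicit Defensive.

Import Order.TTheory GRing.Theory Num.Theory.

Local Open Scope fset_scope.
Local Open Scope ring_scope.

(* A tree in the sense of finite graph theory; [e] is meant to be symmetric
   and irreflexive, and closed walks x, y, x are not counted as cycles. *)
Definition is_tree (T : finType) (e : rel T) : Prop :=
  [/\ (0 < #|T|)%N,
      forall x y : T, connect e x y
    & forall c : seq T, ucycle e c -> (size c <= 2)%N].

Section RootSystem.

Variables (R : realFieldType) (V : vectType R) (B : {dot V for idfun}).

(* cartan b a = <b, a^vee>; it is not symmetric in its arguments. *)
Definition cartan (b a : V) : R := 2 * B b a / B a a.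

Definition refl (a b : V) : V := b - cartan b a *: a.

Definition root_system (Delta : {fset V}) : Prop :=
  [/\ (0 \notin Delta) && (<<Delta>>%VS == fullv),
      {in Delta &, forall a b, refl a b \in Delta},
      {in Delta &, forall a b, exists k : int, cartan b a = k%:~R}
    & (* reduced *)
      {in Delta, forall (a : V) (c : R),
        c *: a \in Delta -> (c == 1) || (c == -1)}].

Definition irreducible (Delta : {fset V}) : Prop :=
  Delta != fset0 /\
  forall A : {fset V}, A `<=` Delta -> A != fset0 -> A != Delta ->
    exists a b, [/\ a \in A, b \in Delta `\` A & B a b != 0].

Definition long (Delta : {fset V}) (a : V) : bool :=
  (a \in Delta) && all (fun b => B b b <= B a a) Delta.

Definition short (Delta : {fset V}) (a : V) : bool :=
  (a \in Delta) && ~~ long Delta a.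

Definition nncomb (Pi : {fset V}) (x : V) : Prop :=
  exists c : V -> nat, x = \sum_(a <- Pi) a *+ c a.

Definition simple_roots (Delta Pi : {fset V}) : Prop :=
  [/\ Pi `<=` Delta,
      basis_of fullv Pi
    & {in Delta, forall a, nncomb Pi a \/ nncomb Pi (- a)}].

Definition posroots (Delta Pi : {fset V}) : {fset V} :=
  [fset a in Delta | `[< nncomb Pi a >]].

Definition rle (Pi : {fset V}) (mu nu : V) : bool := `[< nncomb Pi (nu - mu) >].

Definition highest_root (Delta Pi : {fset V}) (theta : V) : Prop :=
  theta \in posroots Delta Pi /\
  {in posroots Delta Pi, forall a, rle Pi a theta}.

Definition fundamental_weight (Pi : {fset V}) (w : V) : Prop :=
  exists2 a, a \in Pi & {in Pi, forall b, cartan w b = (b == a)%:R}.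

Section Ideals.

Variables (Delta Pi : {fset V}).

Definition upper_ideal (I : {fset V}) : Prop :=
  I `<=` posroots Delta Pi /\
  forall nu a, nu \in I -> a \in posroots Delta Pi -> rle Pi nu a -> a \in I.

Definition abelian_ideal (I : {fset V}) : Prop :=
  upper_ideal I /\ {in I &, forall a b, a + b \notin posroots Delta Pi}.

Definition ideal_ge (a : V) : {fset V} :=
  [fset nu in posroots Delta Pi | rle Pi a nu].

Definition commutative_root (a : V) : Prop :=
  a \in posroots Delta Pi /\ abelian_ideal (ideal_ge a).

(* V (+) R delta is encoded as V * R: the pair (x, t) stands for x + t delta. *)

Definition affine_positive (x : V * R) : Prop :=
  exists a (k : int), x = (a, k%:~R) /\
    ((1 <= k)%R && (a \in Delta) \/ (k == 0) && (a \in posroots Delta Pi)).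

Definition affine_refl (a : V) (k : int) (x : V * R) : V * R :=
  (refl a x.1, x.2 - k%:~R * cartan x.1 a).

(* Reflections are involutive, so the monoid they generate is a group. *)
Inductive affine_weyl : (V * R -> V * R) -> Prop :=
| affine_weyl_id : affine_weyl id
| affine_weyl_refl a k w :
    a \in Delta -> affine_weyl w -> affine_weyl (affine_refl a k \o w).

Definition inversion (w : V * R -> V * R) (x : V * R) : Prop :=
  affine_positive x /\ affine_positive (- w x).

(* w = w_I, the element of the affine Weyl group attached to I by Peterson:
   N(w) = {delta - a | a in I}. *)
Definition peterson (I : {fset V}) (w : V * R -> V * R) : Prop :=
  affine_weyl w /\
  forall x, inversion w x <-> exists2 a, a \in I & x = (- a, 1).

(* rt(I) = mu; theta is the highest root, and (- theta, 2) is
   2 delta - theta. *)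
Definition has_rootlet (theta : V) (I : {fset V}) (mu : V) : Prop :=
  [/\ abelian_ideal I, I != fset0
    & exists2 w, peterson I w & w (- theta, 2) = (mu, 0)].

(* I = I(mu)_max. The maximal element is known to be unique for long mu, so
   that this relation is functional. *)
Definition is_Imax (theta mu : V) (I : {fset V}) : Prop :=
  has_rootlet theta I mu /\
  forall J, has_rootlet theta J mu -> I `<=` J -> J = I.

Definition amazing (theta a : V) : Prop :=
  [/\ a \in posroots Delta Pi, long Delta a & is_Imax theta a (ideal_ge a)].

(* The amazing roots that are not orthogonal to theta. *)
Definition amazingH (theta : V) : {fset V} :=
  [fset a in posroots Delta Pi | `[< amazing theta a >] && (B a theta != 0)].

End Ideals.

Section Diagrams.

Variables (Delta Pi : {fset V}).

(* nu covers mu in the subposet S *)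
Definition covers (S : {fset V}) (nu mu : V) : bool :=
  [&& mu \in S, nu \in S, mu != nu, rle Pi mu nu &
    all (fun x => rle Pi mu x && rle Pi x nu ==> (x == mu) || (x == nu)) S].

Definition hasse_adj (S : {fset V}) : rel V :=
  fun x y => covers S x y || covers S y x.

Definition hasse (S : {fset V}) : rel S := relpre val (hasse_adj S).

Definition hasse_edges (S : {fset V}) : {fset V * V} :=
  [fset p in S `*` S | covers S p.1 p.2].

(* The natural labelling of the edges of a Hasse diagram of roots: the edge
   joining mu to a root nu covering it is labelled by nu - mu. *)
Definition edge_label (p : V * V) : V := p.1 - p.2.

Definition edges_biject (S P : {fset V}) : Prop :=
  {in hasse_edges S &, injective edge_label} /\
  [fset edge_label p | p in hasse_edges S] = P.

(* Nodes of the extended Dynkin diagram: None is the extra node. *)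
Definition ext_node : finType := option Pi.

Definition node_root (theta : V) (x : ext_node) : V :=
  if x is Some a then val a else - theta.

(* The number of lines joining two distinct nodes. *)
Definition lines (theta : V) (x y : ext_node) : R :=
  cartan (node_root theta x) (node_root theta y) *
  cartan (node_root theta y) (node_root theta x).

Definition long_nodes (theta : V) : {set ext_node} :=
  [set x | long Delta (node_root theta x)].

Definition nodes_biject (D : {set ext_node}) (S : {fset V})
    (phi : ext_node -> V) : Prop :=
  {in D &, injective phi} /\ [fset phi x | x in D] = S.

(* phi identifies the sub-diagram on the node set D with the Hasse diagram of
   S, lines being counted with multiplicity. *)
Definition diagram_iso (theta : V) (D : {set ext_node}) (S : {fset V})
    (phi : ext_node -> V) : Prop :=
  nodes_biject D S phi /\
  {in D &, forall x y, x != y ->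
    lines theta x y = (hasse_adj S (phi x) (phi y))%:R}.

(* The same for the underlying graphs, i.e. disregarding the multiplicities,
   which a Hasse diagram cannot record. *)
Definition graph_iso (theta : V) (D : {set ext_node}) (S : {fset V})
    (phi : ext_node -> V) : Prop :=
  nodes_biject D S phi /\
  {in D &, forall x y, x != y ->
    (lines theta x y != 0) = hasse_adj S (phi x) (phi y)}.

End Diagrams.

End RootSystem.

(* Main.v *)
(** Let [at0] be the simple root not orthogonal to [theta].  An affine Weyl
    group element is a pair of an isometry [u] of [V] and an integral linear
    form [l].  Reading off from the signs of [u g] and the values [l g] which
    positive roots [g] lie in an abelian ideal [J] with rootlet [a], and pairing
    with [theta], one gets: the number of elements of [J], other than [theta],
    that are not orthogonal to [theta] is the height of the coroot of
    [theta - a].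

    The Dynkin diagram is a tree; root it at [at0] and let [k b] be the sum of
    the simple roots on the path from [at0] to [b].  The roots above
    [theta - k b] are [theta] and the [theta - k t] with [t] on that path, and
    they form an abelian ideal.  If [b] is long, so is the whole path, the
    product of the reflections along it exhibits [theta - k b] as the rootlet,
    and the count makes this ideal maximal.  Conversely, if [a] is amazing, not
    orthogonal to [theta] and not [theta] itself, the count says that the
    interval from [at0] to [theta - a] has as few elements as possible, which
    forces it to be a chain of long
    path sums.  Hence the amazing roots not orthogonal to [theta] are [theta]
    and the [theta - k b] with [b] long; their order is that of the tree, and
    [theta - k b] is joined to the root covering it by an edge with label [b].
    Adding the [theta - k b] with [b] short gives (iii). *)

Require Import Defs.
From mathcomp Require Import all_boot all_order all_algebra.
From mathcomp Require Import finmap boolp.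
From mathcomp Require Import ring lra zify.
Set Implicit Arguments.
Unset Strict Implicit.
Unset Printing Implicit Defensive.

Import Order.TTheory GRing.Theory Num.Theory.
Local Open Scope fset_scope.
Local Open Scope ring_scope.

(** * Bilinear forms and reflections *)

Section Form.

Variables (R : realFieldType) (V : vectType R) (B : {dot V for idfun}).
Implicit Types x y z : V.

Lemma formC x y : B x y = B y x.
Proof. by rewrite hermC expr0 mul1r. Qed.

Lemma formDl x y z : B (x + y) z = B x z + B y z.
Proof. exact: linearDl. Qed.

Lemma formDr x y z : B z (x + y) = B z x + B z y.
Proof. exact: linearDr. Qed.

Lemma formNl x y : B (- x) y = - B x y.
Proof. exact: linearNl. Qed.

Lemma formNr x y : B x (- y) = - B x y.
Proof. exact: linearNr. Qed.

Lemma formZl (c : R) x y : B (c *: x) y = c * B x y.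
Proof. exact: linearZl_LR. Qed.

Lemma formZr (c : R) x y : B x (c *: y) = c * B x y.
Proof. exact: linearZr_LR. Qed.

Lemma form0l x : B 0 x = 0.
Proof. exact: linear0l. Qed.

Definition formE := (formDl, formDr, formNl, formNr, formZl, formZr).

Lemma form_suml (I : Type) (r : seq I) (P : pred I) (F : I -> V) y :
  B (\sum_(i <- r | P i) F i) y = \sum_(i <- r | P i) B (F i) y.
Proof. exact: linear_sumlz. Qed.

Lemma form_sumr (I : Type) (r : seq I) (P : pred I) (F : I -> V) y :
  B y (\sum_(i <- r | P i) F i) = \sum_(i <- r | P i) B y (F i).
Proof. exact: linear_sumr. Qed.

Lemma norm_gt0 x : x != 0 -> 0 < B x x.
Proof. exact: neq0_dnorm_gt0. Qed.

Lemma norm_ge0 x : 0 <= B x x.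
Proof. by have [->|/norm_gt0/ltW//] := eqVneq x 0; rewrite form0l. Qed.

Lemma norm_le0 x : B x x <= 0 -> x = 0.
Proof. by move=> h; apply/eqP; apply/negPn/negP => /norm_gt0; rewrite ltNge h. Qed.

Lemma cartanM x y : y != 0 -> cartan B x y * B y y = 2 * B x y.
Proof. by move=> /norm_gt0 h; rewrite /cartan divfK // gt_eqF. Qed.

Lemma cartanDl x y z : cartan B (x + y) z = cartan B x z + cartan B y z.
Proof. by rewrite /cartan formDl mulrDr mulrDl. Qed.

Lemma cartanNl x y : cartan B (- x) y = - cartan B x y.
Proof. by rewrite /cartan formNl mulrN mulNr. Qed.

Lemma cartanNr x y : cartan B x (- y) = - cartan B x y.
Proof. by rewrite /cartan formNl !formNr opprK mulrN mulNr. Qed.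

Lemma cartanZl (c : R) x y : cartan B (c *: x) y = c * cartan B x y.
Proof. by rewrite /cartan formZl mulrCA !mulrA. Qed.

Lemma cartanxx x : x != 0 -> cartan B x x = 2.
Proof. by move=> /norm_gt0 h; rewrite /cartan mulfK // gt_eqF. Qed.

Lemma reflN x y : refl B x (- y) = - refl B x y.
Proof. by rewrite /refl cartanNl scaleNr opprD. Qed.

Lemma reflNl x y : refl B (- x) y = refl B x y.
Proof. by rewrite /refl cartanNr scaleNr scalerN opprK. Qed.

Lemma reflD x y z : refl B x (y + z) = refl B x y + refl B x z.
Proof. by rewrite /refl cartanDl scalerDl opprD addrACA. Qed.

Lemma reflZ x (c : R) y : refl B x (c *: y) = c *: refl B x y.
Proof. by rewrite /refl cartanZl scalerBr scalerA. Qed.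

Lemma reflxx x : x != 0 -> refl B x x = - x.
Proof.
move=> h; rewrite /refl cartanxx // scaler_nat mulr2n opprD addrA subrr.
by rewrite add0r.
Qed.

Lemma refl_ortho x y : B y x = 0 -> refl B x y = y.
Proof. by rewrite /refl /cartan => ->; rewrite mulr0 mul0r scale0r subr0. Qed.

Lemma form_refl x y z : x != 0 -> B (refl B x y) (refl B x z) = B y z.
Proof.
move=> x0; have h1 := cartanM y x0; have h2 := cartanM z x0.
rewrite /refl !formE (formC x z); set n := B x x in h1 h2 *.
have -> : B y x = cartan B y x * n / 2 by rewrite h1; field.
have -> : B z x = cartan B z x * n / 2 by rewrite h2; field.
by field.
Qed.

Lemma form_refl_adj x y z : B (refl B x y) z = B y (refl B x z).
Proof.
by rewrite /refl /cartan !formE (formC x z); ring.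
Qed.

Lemma reflK x y : x != 0 -> refl B x (refl B x y) = y.
Proof.
move=> x0; rewrite {2}/refl reflD reflN reflZ reflxx // /refl.
by rewrite scalerN opprK subrK.
Qed.

End Form.

(** * Self-maps of finite sets and ranked graphs *)

Lemma perm_map_self (T : choiceType) (A : {fset T}) (f : T -> T) :
  {in A, forall x, f x \in A} -> {in A &, injective f} -> perm_eq (map f A) A.
Proof.
move=> fs fi; have ums : uniq (map f A) by rewrite map_inj_in_uniq ?fset_uniq.
have sub : {subset map f A <= A} by move=> _ /mapP[x xs ->]; apply: fs.
have le : (size A <= size (map f A))%N by rewrite size_map.
have [_ h] := uniq_min_size ums sub le.
by apply: uniq_perm => //; apply: fset_uniq.
Qed.

(** Descending in rank connects every vertex to [r]. On a cycle of length at least three, a vertex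
    of maximal rank would have two distinct neighbours of rank not exceeding its own. *)
Lemma ranked_tree (T : finType) (e : rel T) (r : T) (h : T -> nat) :
  symmetric e -> (forall x, x != r -> exists2 y, e x y & (h y < h x)%N) ->
  (forall x y z, e x y -> e x z -> (h y <= h x)%N -> (h z <= h x)%N -> y = z) ->
  is_tree e.
Proof.
move=> es down uniq_down.
have root x : connect e x r.
  have [n] := ubnP (h x); elim: n x => // n IH x; rewrite ltnS => hx.
  have [->|ne] := eqVneq x r; first exact: connect0.
  have [y exy hy] := down x ne; apply: connect_trans (connect1 exy) _.
  by apply: IH; apply: leq_trans hx.
split=> [|x y|c /andP[cc uc]].
- by apply/card_gt0P; exists r.
- apply: connect_trans (root x) _.
  by rewrite (sym_connect_sym es) root.
rewrite leqNgt; apply/negP => c2.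
have [x0 hx0] : exists x, x \in c.
  by case: c c2 {cc uc} => // a s _; exists a; rewrite inE eqxx.
pose x := [arg max_(i > x0 in c) h i].
have [xc xmax] : x \in c /\ forall y, y \in c -> (h y <= h x)%N.
  by rewrite /x; case: arg_maxnP => // i ? ?; split.
have [i s es'] := rot_to xc.
have := rot_cycle i e c; rewrite cc es' => cs.
have := rot_uniq i c; rewrite uc es' => us.
have ms y : y \in x :: s -> (h y <= h x)%N by rewrite -es' mem_rot => /xmax.
have ss : (2 < size (x :: s))%N by rewrite -es' size_rot.
case: s {es'} cs us ms ss => [|y [|z s]] // cs us ms _.
move: cs => /=; rewrite rcons_path => /and3P[exy _ /andP[_ elx]].
rewrite es in elx.
have lz : last z s \in z :: s by apply: mem_last.
have e1 : y = last z s.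
  apply: (uniq_down x) => //; first by apply: ms; rewrite !inE eqxx orbT.
  by apply: ms; rewrite !(in_cons x) !(in_cons y) lz !orbT.
by move: us; rewrite !cons_uniq e1 lz /= andbF.
Qed.

(** * Positive roots *)

Section RootSystem.

Variables (R : realFieldType) (V : vectType R) (B : {dot V for idfun}).
Variables (Delta Pi : {fset V}).
Hypothesis hDelta : root_system B Delta.
Hypothesis hPi : simple_roots Delta Pi.

Implicit Types (a b g x y z : V) (X Y : {fset V}).

Local Notation Dp := (posroots Delta Pi).

Lemma root_neq0 a : a \in Delta -> a != 0.
Proof.
by case: hDelta => /andP[h _] _ _ _ ha; apply: contraNneq h => <-.
Qed.

Lemma root_norm a : a \in Delta -> 0 < B a a.
Proof. by move=> /root_neq0/norm_gt0. Qed.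

Lemma root_refl a b : a \in Delta -> b \in Delta -> refl B a b \in Delta.
Proof. by case: hDelta => _ h _ _ ha hb; apply: h. Qed.

Lemma rootN a : a \in Delta -> - a \in Delta.
Proof. by move=> ha; rewrite -(reflxx B (root_neq0 ha)) root_refl. Qed.

Lemma rootNE a : (- a \in Delta) = (a \in Delta).
Proof. by apply/idP/idP => /rootN; rewrite ?opprK. Qed.

Lemma cartan_int a b : a \in Delta -> b \in Delta ->
  exists k : int, cartan B a b = k%:~R.
Proof. by case: hDelta => _ _ h _ ha hb; apply: h. Qed.

Lemma cartan_lt0 a b : a \in Delta -> b \in Delta -> B a b < 0 ->
  cartan B a b = -1 \/ cartan B a b <= -2.
Proof.
move=> ha hb hab; have [k hk] := cartan_int ha hb.
have : cartan B a b < 0.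
  by rewrite /cartan pmulr_llt0 ?invr_gt0 ?root_norm // pmulr_rlt0.
rewrite hk ltrz0 => k0.
have [->|k1] := eqVneq k (-1); first by left.
by right; rewrite -[-2]/((-2)%:~R) ler_int; lia.
Qed.

Lemma cartan_le0 a b : a \in Delta -> b \in Delta -> B a b < 0 ->
  2 * B a b <= - B b b.
Proof.
move=> ha hb hab; have hb0 := root_norm hb.
have := cartanM B a (root_neq0 hb).
have : cartan B a b <= -1 by case: (cartan_lt0 ha hb hab) => ?; lra.
by nra.
Qed.

(** If one of the two Cartan integers is -1, the corresponding reflection produces [a + b]. If both
    are at most -2, then [a + b] has norm at most 0. *)
Lemma rootD a b : a \in Delta -> b \in Delta -> B a b < 0 -> a + b != 0 ->
  a + b \in Delta.
Proof.
move=> ha hb hab hn.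
have hba : B b a < 0 by rewrite formC.
have [h1|h1] := cartan_lt0 ha hb hab.
  by have := root_refl hb ha; rewrite /refl h1 scaleN1r opprK.
have [h2|h2] := cartan_lt0 hb ha hba.
  by have := root_refl ha hb; rewrite /refl h2 scaleN1r opprK addrC.
have := norm_gt0 B hn; rewrite !formE (formC B b a) => hs.
have ha0 := root_norm ha; have hb0 := root_norm hb.
have := cartanM B a (root_neq0 hb); have := cartanM B b (root_neq0 ha).
rewrite (formC B b a) => e1 e2; exfalso; nra.
Qed.

Lemma rootB a b : a \in Delta -> b \in Delta -> 0 < B a b -> a != b ->
  a - b \in Delta.
Proof.
move=> ha hb hab hn; apply: rootD; rewrite ?rootN ?formNr ?oppr_lt0 //.
by rewrite subr_eq0.
Qed.

(* Zero if [b] is not a simple root. *)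
Definition cf b x : R :=
  \sum_(i < size Pi | (enum_fset Pi)`_i == b) coord (in_tuple Pi) i x.

Lemma cfD b x y : cf b (x + y) = cf b x + cf b y.
Proof. by rewrite -big_split /=; apply: eq_bigr => i _; rewrite linearD. Qed.

Lemma cfZ b (c : R) x : cf b (c *: x) = c * cf b x.
Proof. by rewrite /cf mulr_sumr; apply: eq_bigr => i _; rewrite linearZ. Qed.

Lemma cfN b x : cf b (- x) = - cf b x.
Proof. by rewrite -scaleN1r cfZ mulN1r. Qed.

Lemma cfB b x y : cf b (x - y) = cf b x - cf b y.
Proof. by rewrite cfD cfN. Qed.

Lemma cf0 b : cf b 0 = 0.
Proof. by rewrite -[0](scale0r 0) cfZ mul0r. Qed.

Lemma cfMn b x n : cf b (x *+ n) = cf b x * n%:R.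
Proof. by rewrite -scaler_nat cfZ mulrC. Qed.

Lemma cf_sum b (I : Type) (r : seq I) (P : pred I) (F : I -> V) :
  cf b (\sum_(i <- r | P i) F i) = \sum_(i <- r | P i) cf b (F i).
Proof. by apply: (big_morph _ (cfD b) (cf0 b)). Qed.

Lemma cfE x : x = \sum_(b <- Pi) cf b x *: b.
Proof.
case: hPi => _ hb _.
rewrite {1}(@coord_basis _ _ _ _ (in_tuple Pi) x hb (memvf x)).
rewrite /cf; under [RHS]eq_bigr => b _ do rewrite scaler_suml.
rewrite (exchange_big_dep xpredT) //=; apply: eq_bigr => i _.
rewrite (big_rem (enum_fset Pi)`_i) ?mem_nth //= eqxx.
rewrite big1_seq ?addr0 // => b /andP[/eqP <-].
by rewrite mem_rem_uniq ?fset_uniq // !inE eqxx.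
Qed.

Lemma cf_simple a b : a \in Pi -> b \in Pi -> cf b a = (b == a)%:R.
Proof.
move=> ha hb; case: hPi => _ /andP[_ hf] _.
have hi : (index a Pi < size Pi)%N by rewrite index_mem.
have ea : a = (in_tuple Pi)`_(Ordinal hi) by rewrite /= nth_index.
rewrite /cf {1}ea; under eq_bigr => i _ do rewrite coord_free //.
rewrite (eq_bigr (fun i : 'I_(size Pi) => (a == (enum_fset Pi)`_i)%:R)).
  have hj : (index b Pi < size Pi)%N by rewrite index_mem.
  rewrite (big_pred1 (Ordinal hj)) /= ?nth_index // 1?eq_sym //.
  move=> i /=; rewrite -val_eqE /=; apply/eqP/eqP => [<-|->].
    by rewrite index_uniq ?fset_uniq.
  by rewrite nth_index.
move=> i _; rewrite -val_eqE /=; congr (_%:R); congr nat_of_bool.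
apply/eqP/eqP => e; first by rewrite -e nth_index.
by rewrite e index_uniq ?fset_uniq.
Qed.

Lemma cf_inj x y : {in Pi, forall b, cf b x = cf b y} -> x = y.
Proof.
move=> h; rewrite [x]cfE [y]cfE; apply: eq_big_seq => b hb.
by rewrite h.
Qed.

Lemma nncombP x :
  nncomb Pi x <-> {in Pi, forall b, exists n : nat, cf b x = n%:R}.
Proof.
split=> [[c ->] b hb|h].
  exists (c b); rewrite cf_sum (bigD1_seq b) ?fset_uniq //=.
  rewrite cfMn cf_simple // eqxx mul1r big1_seq ?addr0 // => a /andP[ab ha].
  by rewrite cfMn cf_simple // eq_sym (negPf ab) mul0r.
(* The coefficient function has to be total on [V], so it takes the value 0 where the coordinate is
   not known to be a natural number. *)
exists (fun b => if pselect (exists n : nat, cf b x = n%:R) is left e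
                 then projT1 (cid e) else 0).
rewrite {1}[x]cfE; apply: eq_big_seq => b hb /=.
case: pselect => [e|ne]; last by case: ne; apply: h.
by case: (cid e) => n /= ->; rewrite scaler_nat.
Qed.

Lemma rleP x y :
  reflect {in Pi, forall b, exists n : nat, cf b y - cf b x = n%:R}
          (rle Pi x y).
Proof.
apply: (iffP (asboolP _)).
  by move/nncombP => h b /h; rewrite cfB.
by move=> h; apply/nncombP => b /h; rewrite cfB.
Qed.

Lemma rle_cf x y b : rle Pi x y -> b \in Pi -> cf b x <= cf b y.
Proof. by move=> /rleP h /h[n hn]; rewrite -subr_ge0 hn ler0n. Qed.

Lemma rle_refl x : rle Pi x x.
Proof. by apply/rleP => b _; exists 0; rewrite subrr. Qed.

Lemma rle_trans y x z : rle Pi x y -> rle Pi y z -> rle Pi x z.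
Proof.
move=> /rleP h1 /rleP h2; apply/rleP => b hb.
have [n hn] := h1 b hb; have [m hm] := h2 b hb.
by exists (m + n)%N; rewrite natrD -hn -hm; ring.
Qed.

Lemma rle_anti x y : rle Pi x y -> rle Pi y x -> x = y.
Proof.
move=> h1 h2; apply: cf_inj => b hb; apply: le_anti.
by rewrite !rle_cf.
Qed.

Lemma simple_root b : b \in Pi -> b \in Delta.
Proof. by case: hPi => /fsubsetP h _ _ /h. Qed.

Lemma mem_posP g : reflect (g \in Delta /\ nncomb Pi g) (g \in Dp).
Proof.
rewrite !inE /=; apply: (iffP andP) => -[h1 h2]; split=> //; exact/asboolP.
Qed.

Lemma pos_root g : g \in Dp -> g \in Delta.
Proof. by case/mem_posP. Qed.

Lemma pos_or_neg g : g \in Delta -> g \in Dp \/ - g \in Dp.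
Proof.
move=> hg; case: hPi => _ _ /(_ g hg)[h|h]; [left|right];
  by apply/mem_posP; rewrite ?rootN.
Qed.

Lemma pos_cf g b : g \in Dp -> b \in Pi -> exists n : nat, cf b g = n%:R.
Proof. by move=> /mem_posP[_ /nncombP h] /h. Qed.

Lemma pos_cf_ge0 g b : g \in Dp -> b \in Pi -> 0 <= cf b g.
Proof. by move=> hg /(pos_cf hg)[n ->]. Qed.

Lemma pos_cf_ge1 g b : g \in Dp -> b \in Pi -> cf b g != 0 -> 1 <= cf b g.
Proof.
by move=> hg /(pos_cf hg)[n ->]; rewrite pnatr_eq0 ler1n lt0n.
Qed.

Lemma pos_of_cf g b : g \in Delta -> b \in Pi -> 0 < cf b g -> g \in Dp.
Proof.
move=> /pos_or_neg[//|h] hb h0; have := pos_cf_ge0 h hb.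
by rewrite cfN oppr_ge0 leNgt h0.
Qed.

Lemma posN g : g \in Dp -> - g \notin Dp.
Proof.
move=> hg; apply/negP => hn; have /negP := root_neq0 (pos_root hg); apply.
apply/eqP/cf_inj => b hb; rewrite cf0; apply: le_anti.
by rewrite (pos_cf_ge0 hg) // andbT -oppr_ge0 -cfN (pos_cf_ge0 hn).
Qed.

Lemma simple_pos b : b \in Pi -> b \in Dp.
Proof.
by move=> hb; apply: (@pos_of_cf _ b); rewrite ?simple_root // cf_simple // eqxx.
Qed.

Lemma formcf x y : B x y = \sum_(b <- Pi) cf b x * B b y.
Proof.
rewrite {1}[x]cfE form_suml; apply: eq_bigr => b _; by rewrite formZl.
Qed.

Lemma simple_form_le0 a b : a \in Pi -> b \in Pi -> a != b -> B a b <= 0.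
Proof.
move=> ha hb ab; rewrite leNgt; apply/negP => h.
have hr := rootB (simple_root ha) (simple_root hb) h ab.
have h1 : a - b \in Dp.
  by apply: (@pos_of_cf _ a); rewrite ?cfB ?cf_simple // eqxx (negPf ab) subr0.
have := pos_cf_ge0 h1 hb.
by rewrite cfB !cf_simple // eqxx eq_sym (negPf ab) sub0r oppr_ge0 ler10.
Qed.

(* A positive root other than [b] has a positive coordinate at a simple root
   different from [b], which subtracting a multiple of [b] does not change. *)
Lemma pos_subZ g b (c : R) : g \in Dp -> b \in Pi -> g != b ->
  g - c *: b \in Delta -> g - c *: b \in Dp.
Proof.
move=> hg hb gb hr.
have [a [ha ab ag]] : exists a, [/\ a \in Pi, a != b & cf a g != 0].
  apply: contrapT => hn.
  have eg : g = cf b g *: b.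
    apply: cf_inj => a ha; rewrite cfZ (cf_simple hb ha).
    have [->|ab] := eqVneq a b; first by rewrite mulr1.
    rewrite mulr0; apply/eqP/negPn/negP => h; apply: hn; by exists a.
  case: hDelta => _ _ _ /(_ b (simple_root hb) (cf b g)).
  rewrite -eg => /(_ (pos_root hg))/orP[]/eqP h.
    by move: gb; rewrite eg h scale1r eqxx.
  by have := pos_cf_ge0 hg hb; rewrite h; lra.
apply: (pos_of_cf hr ha).
rewrite cfB cfZ (cf_simple hb ha) (negPf ab) mulr0 subr0.
by have := pos_cf_ge1 hg ha ag; lra.
Qed.

Lemma refl_pos g b : g \in Dp -> b \in Pi -> g != b -> refl B b g \in Dp.
Proof.
move=> hg hb gb; apply: pos_subZ => //.
by have := root_refl (simple_root hb) (pos_root hg).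
Qed.

Lemma pos_subr g b : g \in Dp -> b \in Pi -> g != b -> 0 < B g b ->
  g - b \in Dp.
Proof.
move=> hg hb gb h; have hr := rootB (pos_root hg) (simple_root hb) h gb.
by move: hr; rewrite -[b]scale1r => hr; apply: pos_subZ.
Qed.

(** Otherwise expanding one argument of [B g g] in simple roots would make the norm nonpositive. *)
Lemma pos_descent g : g \in Dp -> exists2 b, b \in Pi & 0 < B g b.
Proof.
move=> hg; apply: contrapT => hn; have := root_norm (pos_root hg).
rewrite ltNge => /negP; apply; rewrite {1}formcf big_seq sumr_le0 // => b hb.
rewrite mulr_ge0_le0 ?pos_cf_ge0 // formC leNgt; apply/negP => h.
by apply: hn; exists b.
Qed.

Lemma rle_lt_sum x y : rle Pi x y -> x != y ->
  \sum_(b <- Pi) cf b x < \sum_(b <- Pi) cf b y.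
Proof.
move=> h xy; rewrite lt_neqAle andbC !big_seq ler_sum /=; last first.
  by move=> b; apply: rle_cf.
apply: contraNneq xy => e; apply/eqP; apply: rle_anti => //.
apply/rleP => b hb; exists 0%N; apply/eqP; rewrite subr_eq0.
have : \sum_(a <- Pi | a \in Pi) (cf a y - cf a x) == 0.
  by rewrite sumrB e subrr.
rewrite psumr_eq0 => [/allP/(_ b hb)|a ha]; last first.
  by rewrite subr_ge0 rle_cf.
by rewrite hb /= => /eqP h0; rewrite -subr_eq0 -oppr_eq0 opprB h0.
Qed.

(** Induction on the height, the sum of the coordinates, which is a natural number for a positive
    root. *)
Lemma pos_ind (P : V -> Prop) :
  (forall g, g \in Dp -> (forall g', g' \in Dp -> rle Pi g' g -> g' != g ->
     P g') -> P g) -> forall g, g \in Dp -> P g.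
Proof.
move=> IH g hg.
have hn x : x \in Dp -> exists n : nat, \sum_(b <- Pi) cf b x = n%:R.
  move=> hx; rewrite big_seq; elim/big_ind: _ => [|u v [n ->] [m ->]|b hb].
  - by exists 0%N.
  - by exists (n + m)%N; rewrite natrD.
  - exact: pos_cf.
have [n] := hn g hg; have [m] := ubnP n.
elim: m n g hg => // m IHm n g hg; rewrite ltnS => nm e.
apply: IH => // g' hg' le' ne'; have [n' e'] := hn g' hg'.
apply: (IHm n') => //; have := rle_lt_sum le' ne'.
by rewrite e e' ltr_nat => h; apply: leq_trans nm.
Qed.

(** Pairing with the sum of the positive roots, twice the Weyl vector. For a long root [x], dividing
    by the norm of [x] gives the height of the coroot of [x]. *)
Definition hsum x : R := \sum_(g <- Dp) B g x.

Lemma hsumB x y : hsum (x - y) = hsum x - hsum y.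
Proof. by rewrite /hsum -sumrB; apply: eq_bigr => g _; rewrite !formE. Qed.

Lemma hsumN x : hsum (- x) = - hsum x.
Proof. by rewrite /hsum -sumrN; apply: eq_bigr => g _; rewrite formNr. Qed.

Lemma hsumZ (c : R) x : hsum (c *: x) = c * hsum x.
Proof. by rewrite /hsum mulr_sumr; apply: eq_bigr => g _; rewrite formZr. Qed.

(** The reflection in [b] permutes the positive roots other than [b]. Reindexing one of two copies
    of the sum along it cancels every term except the two at [b]. *)
Lemma hsum_simple b : b \in Pi -> hsum b = B b b.
Proof.
move=> hb; pose f g := if g == b then b else refl B b g.
have b0 := root_neq0 (simple_root hb).
have pf : perm_eq (map f Dp) Dp.
  apply: perm_map_self => [g hg|g g' hg hg'].
    by rewrite /f; have [_|gb] := eqVneq g b; [apply: simple_pos|apply: refl_pos].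
  rewrite /f; have [->|gb] := eqVneq g b; have [->|gb'] := eqVneq g' b => //.
  - move=> e; have /negP[] := posN (simple_pos hb).
    by have := congr1 (refl B b) e; rewrite reflxx // reflK // => ->.
  - move=> e; have /negP[] := posN (simple_pos hb).
    by have := congr1 (refl B b) e; rewrite reflxx // reflK // => <-.
  - by move/(congr1 (refl B b)); rewrite !reflK.
have : hsum b + hsum b = 2 * B b b.
  rewrite {2}/hsum -(perm_big _ pf) big_map -big_split /=.
  rewrite (bigD1_seq b) ?fset_uniq ?simple_pos //= /f eqxx.
  rewrite big1 => [|g /negPf ->]; first by ring.
  by rewrite form_refl_adj reflxx // formNr addrN.
by lra.
Qed.

Lemma refl_le_cf g b : g \in Delta -> b \in Pi -> 0 < B g b ->
  rle Pi (refl B b g) g.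
Proof.
move=> hg hb h; apply/rleP => a ha.
have [k hk] := cartan_int hg (simple_root hb).
have : 0 < cartan B g b.
  by rewrite /cartan pmulr_lgt0 ?invr_gt0 ?root_norm ?simple_root // pmulr_rgt0.
rewrite /refl cfB cfZ (cf_simple hb ha) hk ltr0z.
case: k {hk} => // n _; exists (n * (a == b))%N.
by rewrite natrM pmulrn; ring.
Qed.

Lemma refl_ge_cf g b : g \in Delta -> b \in Pi -> B g b < 0 ->
  rle Pi g (refl B b g).
Proof.
move=> hg hb h; have b0 := root_neq0 (simple_root hb).
have := @refl_le_cf (refl B b g) b; rewrite reflK //; apply=> //.
  exact: root_refl (simple_root hb) hg.
by rewrite form_refl_adj reflxx // formNr oppr_gt0.
Qed.

Lemma refl_neq g b : b \in Delta -> B g b != 0 -> refl B b g != g.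
Proof.
move=> hb h; have b0 := root_neq0 hb.
rewrite /refl -subr_eq0 addrAC subrr sub0r oppr_eq0 scaler_eq0 (negPf b0) orbF.
by rewrite /cartan !mulf_eq0 invr_eq0 pnatr_eq0 (negPf h) (gt_eqF (root_norm hb)).
Qed.

(** * The highest root *)

Variables (theta at0 : V).
Hypothesis htheta : highest_root Delta Pi theta.
Hypothesis hat0 : at0 \in Pi.
Hypothesis hfw : {in Pi, forall b, cartan B theta b = (b == at0)%:R}.

Local Notation N := (B theta theta).

Lemma th_pos : theta \in Dp. Proof. by case: htheta. Qed.

Lemma th_root : theta \in Delta. Proof. exact: pos_root th_pos. Qed.

Lemma th_max g : g \in Dp -> rle Pi g theta.
Proof. by case: htheta => _; apply. Qed.

Lemma th_neq0 : theta != 0. Proof. exact: root_neq0 th_root. Qed.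

Lemma N_gt0 : 0 < N. Proof. exact: root_norm th_root. Qed.

Lemma at_root : at0 \in Delta. Proof. exact: simple_root hat0. Qed.

Lemma at_pos : at0 \in Dp. Proof. exact: simple_pos hat0. Qed.

Lemma th_ortho b : b \in Pi -> b != at0 -> B theta b = 0.
Proof.
move=> hb /negPf ne; have := cartanM B theta (root_neq0 (simple_root hb)).
by rewrite hfw // ne mulr0n; lra.
Qed.

Lemma th_at : B theta at0 = B at0 at0 / 2.
Proof.
have := cartanM B theta (root_neq0 at_root).
by rewrite hfw // eqxx mulr1n; lra.
Qed.

Lemma th_dom b : b \in Pi -> 0 <= B theta b.
Proof.
move=> hb; have [->|ne] := eqVneq b at0; last by rewrite th_ortho.
by rewrite th_at; have := root_norm at_root; lra.
Qed.

Lemma pos_ind_up (P : V -> Prop) :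
  (forall g, g \in Dp -> (forall g', g' \in Dp -> rle Pi g g' -> g' != g ->
     P g') -> P g) -> forall g, g \in Dp -> P g.
Proof.
move=> IH g hg.
have hn x : x \in Dp -> exists n : nat,
    \sum_(b <- Pi) cf b theta - \sum_(b <- Pi) cf b x = n%:R.
  move=> hx; rewrite -sumrB big_seq.
  elim/big_ind: _ => [|u v [n ->] [m ->]|b hb].
  - by exists 0%N.
  - by exists (n + m)%N; rewrite natrD.
  - by have /rleP := th_max hx; apply.
have [n] := hn g hg; have [m] := ubnP n.
elim: m n g hg => // m IHm n g hg; rewrite ltnS => nm e.
apply: IH => // g' hg' le' ne'; have [n' e'] := hn g' hg'.
rewrite eq_sym in ne'; have hlt := rle_lt_sum le' ne'.
apply: (IHm n') => //; apply: leq_trans nm.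
by rewrite -(ltr_nat R) -e -e'; lra.
Qed.

(* A positive root of maximal height in its Weyl orbit is dominant, and the
   form is monotone on dominant vectors. *)
Lemma th_long g : g \in Delta -> B g g <= N.
Proof.
have main x : x \in Dp -> B x x <= N.
  elim/pos_ind_up => {}x hx IH.
  have [[b [hb h]]|dom] := pselect (exists b, b \in Pi /\ B x b < 0).
    have b0 := root_neq0 (simple_root hb).
    rewrite -(form_refl B x x b0); apply: IH.
    - apply: refl_pos => //; apply: contraTneq h => ->.
      by rewrite -leNgt ltW ?root_norm ?simple_root.
    - by apply: refl_ge_cf => //; apply: pos_root.
    - by apply: refl_neq; rewrite ?simple_root // lt_eqF.
  have d2 y : {in Pi, forall b, 0 <= B b y} -> 0 <= B (theta - x) y.
    move=> hy; rewrite formcf big_seq sumr_ge0 // => b hb.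
    by rewrite mulr_ge0 ?hy // cfB subr_ge0 rle_cf // th_max.
  have := d2 theta _; have := d2 x _; rewrite !formE => h1 h2.
  have : 0 <= B theta x - B x x.
    apply: h1 => b hb; rewrite formC leNgt; apply/negP => h; apply: dom.
    by exists b.
  have : 0 <= B theta theta - B x theta.
    by apply: h2 => b hb; rewrite formC th_dom.
  by rewrite (formC B x theta); lra.
move=> /pos_or_neg[/main//|/main]; by rewrite formNl formNr opprK.
Qed.

Lemma longP g : long B Delta g = (g \in Delta) && (B g g == N).
Proof.
rewrite /long; case hg: (g \in Delta) => //=; apply/allP/eqP => [h|-> b].
  by apply: le_anti; rewrite th_long //= h ?th_root.
exact: th_long.
Qed.

(** A strict Cauchy-Schwarz bound, read off from the positive norms of [a - b] and [a + b]. *)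
Lemma long_pair a b : a \in Delta -> b \in Delta -> B b b = N ->
  a != b -> a != - b -> `|2 * B a b| < 2 * N.
Proof.
move=> ha hb nb h1 h2; have := th_long ha.
have : 0 < B (a - b) (a - b) by rewrite norm_gt0 // subr_eq0.
have : 0 < B (a + b) (a + b) by rewrite norm_gt0 // -[b]opprK subr_eq0.
by rewrite !formE nb (formC B b a) ltr_norml => *; apply/andP; split; lra.
Qed.

Lemma long_cartan a b : a \in Delta -> b \in Delta -> B b b = N ->
  a != b -> a != - b -> [\/ B a b = 0, B a b = N / 2 | B a b = - (N / 2)].
Proof.
move=> ha hb nb h1 h2; have := long_pair ha hb nb h1 h2.
have := cartanM B a (root_neq0 hb); rewrite nb => e.
have [k hk] := cartan_int ha hb; rewrite -e hk normrM (gtr0_norm N_gt0).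
rewrite ltr_pM2r ?N_gt0 // -intr_norm => hk2.
have : (`|k| < 2) by rewrite -(ltr_int R).
move=> hk3; have : (k == 0) || ((k == 1) || (k == -1)) by lia.
case/orP=> [/eqP k0|/orP[/eqP k0|/eqP k0]];
  move: e; rewrite hk k0 ?mulr1z ?mulr0z ?mulrN1z => e.
- by apply: Or31; lra.
- by apply: Or32; lra.
- by apply: Or33; lra.
Qed.

(** The pairing of [at0] with [theta] is positive and half the norm of [at0]; integrality with
    respect to the long root [theta] forces it to be [N / 2]. *)
Lemma at_norm : B at0 at0 = N.
Proof.
have an := root_norm at_root.
have ne : at0 != theta.
  apply/eqP => e; have := th_at; rewrite {1}e => h; move: an h; rewrite -e; lra.
have ne' : at0 != - theta.
  apply/eqP => e; have := posN at_pos; rewrite e opprK th_pos //.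
have := th_long at_root; have := th_at; rewrite formC.
by case: (long_cartan at_root th_root erefl ne ne') => ->; lra.
Qed.

Lemma form_th x : B x theta = cf at0 x * N / 2.
Proof.
rewrite formcf (bigD1_seq at0) ?fset_uniq //= formC th_at at_norm.
rewrite big1_seq; first by ring.
by move=> b /andP[ne hb]; rewrite formC th_ortho // mulr0.
Qed.

Lemma cf_th : cf at0 theta = 2.
Proof.
have := form_th theta; have := N_gt0; move=> h e; apply/eqP.
rewrite -(inj_eq (mulIf (lt0r_neq0 h))); apply/eqP; lra.
Qed.

Lemma cf_th_ge1 b : b \in Pi -> 1 <= cf b theta.
Proof.
move=> hb; have := rle_cf (th_max (simple_pos hb)) hb.
by rewrite cf_simple // eqxx.
Qed.

(** A coordinate at [at0] of 2 or more would give [g - theta] a norm at most 0, since no root is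
    longer than [theta]. *)
Lemma pos_cf01 g : g \in Dp -> g != theta -> cf at0 g = 0 \/ cf at0 g = 1.
Proof.
move=> hg ne; have [n e] := pos_cf hg hat0; rewrite e.
have : 0 < B (g - theta) (g - theta) by rewrite norm_gt0 // subr_eq0.
rewrite !formE (formC B theta g) form_th e => h.
have hl := th_long (pos_root hg).
have : (n < 2)%N.
  rewrite ltnNge -(ler_nat R); apply/negP => hn; have := N_gt0; nra.
by case: n {e h} => [|[|]] // _; [left|right].
Qed.

(** Together with [theta], these are the positive roots not orthogonal to [theta], by [form_th] and
    [pos_cf01]. The map from [g] to [theta - g] is an involution on them. *)
Definition D1 : {fset V} := [fset g in Dp | cf at0 g == 1].

Lemma mem_D1 g : (g \in D1) = (g \in Dp) && (cf at0 g == 1).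
Proof. by rewrite !inE. Qed.

Lemma D1_pos g : g \in D1 -> g \in Dp.
Proof. by rewrite mem_D1 => /andP[]. Qed.

Lemma D1_root g : g \in D1 -> g \in Delta.
Proof. by move=> /D1_pos/pos_root. Qed.

Lemma D1_cf g : g \in D1 -> cf at0 g = 1.
Proof. by rewrite mem_D1 => /andP[_ /eqP]. Qed.

Lemma D1_th g : g \in D1 -> B g theta = N / 2.
Proof. by move=> hg; rewrite form_th D1_cf // mul1r. Qed.

Lemma root_D1 g : g \in Delta -> cf at0 g = 1 -> g \in D1.
Proof.
move=> hg h; rewrite mem_D1 h eqxx andbT; apply: (pos_of_cf hg hat0).
by rewrite h.
Qed.

Lemma D1_neq_th g : g \in D1 -> g != theta.
Proof.
by move=> /D1_cf h; apply/eqP => e; move: h; rewrite e cf_th; lra.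
Qed.

Lemma at_D1 : at0 \in D1.
Proof. by rewrite mem_D1 at_pos cf_simple // !eqxx. Qed.

Lemma D1_compl g : g \in D1 -> theta - g \in D1.
Proof.
move=> hg; apply: root_D1; last by rewrite cfB cf_th D1_cf //; ring.
have h : 0 < B theta g by rewrite formC (D1_th hg); have := N_gt0; lra.
apply: (rootB th_root (D1_root hg) h).
by rewrite eq_sym; apply: D1_neq_th.
Qed.

Lemma D1_compl_norm g : g \in D1 -> B (theta - g) (theta - g) = B g g.
Proof.
by move=> hg; rewrite !formE (formC B theta g) (D1_th hg); field.
Qed.

Lemma D1_refl_th g : g \in D1 -> refl B theta g = g - theta.
Proof.
move=> hg; rewrite /refl; suff -> : cartan B g theta = 1 by rewrite scale1r.
by rewrite /cartan (D1_th hg); field; rewrite gt_eqF ?N_gt0.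
Qed.

(** * The Dynkin diagram as a rooted tree *)

Definition vsum X : V := \sum_(x <- X) x.

(* [p] is the parent map of the Dynkin diagram rooted at [at0], and [A a] is
   the set of nodes on the path from [at0] to [a]. *)
Definition rooted_tree X (p : V -> V) (A : V -> {fset V}) : Prop :=
  [/\ [/\ at0 \in X, X `<=` Pi & A at0 = [fset at0]],
      {in X, forall a, a \in A a /\ A a `<=` X},
      {in X, forall a, a != at0 ->
        [/\ p a \in X, B (p a) a < 0, a \notin A (p a) & A a = a |` A (p a)]}
    & {in X &, forall a b, B a b < 0 ->
        (a != at0 /\ b = p a) \/ (b != at0 /\ a = p b)}].

Lemma simple_adj a b : a \in Pi -> b \in Pi -> a != b -> B a b != 0 -> B a b < 0.
Proof.
by move=> ha hb ab h; rewrite lt_neqAle h simple_form_le0.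
Qed.

Lemma cf_vsum X b : X `<=` Pi -> b \in Pi -> cf b (vsum X) = (b \in X)%:R.
Proof.
move=> /fsubsetP sX hb; rewrite /vsum cf_sum.
rewrite (eq_big_seq (fun x => (b == x)%:R)) => [|x /sX hx]; last exact: cf_simple.
have [bX|bX] := boolP (b \in X).
  rewrite (bigD1_seq b) ?fset_uniq //= eqxx big1 ?addr0 // => x.
  by rewrite eq_sym => /negPf ->.
rewrite big1_seq // => x /andP[_ hx]; case: eqP => // e.
by move: bX; rewrite e hx.
Qed.

Lemma vsumU1 X b : b \notin X -> vsum (b |` X) = b + vsum X.
Proof. by move=> h; rewrite /vsum big_fsetU1. Qed.

Lemma form_vsum_le X b (Y : {fset V}) : X `<=` Pi -> b \in Pi -> b \notin X ->
  Y `<=` X -> B (vsum X) b <= B (vsum Y) b.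
Proof.
move=> sX hb bX sY; rewrite /vsum !form_suml.
rewrite (big_fsetID _ (mem Y)) /= -[leRHS]addr0; apply: lerD.
  rewrite le_eqVlt; apply/orP; left; apply/eqP; apply: eq_fbigl => x.
  by rewrite !inE /= andb_idl // => /(fsubsetP sY).
rewrite big_seq sumr_le0 // => x; rewrite !inE /= => /andP[hx _].
apply: simple_form_le0 => //; first exact: (fsubsetP sX).
by apply: contraNneq bX => <-.
Qed.

(** The norm bound on [vsum X] is the invariant that excludes cycles: a second neighbour [y] of [b]
    in [X] would make the norm of [vsum X + b] at most 0, against linear independence. With the
    single neighbour [x], the inequalities [e1] and [e2] carry the bound over to the larger set. *)
Lemma rooted_tree_grow X p A b x : rooted_tree X p A ->
  {in X, forall y, B (vsum X) (vsum X) <= B y y} ->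
  b \in Pi -> b \notin X -> x \in X -> B x b < 0 ->
  exists p' A', rooted_tree (b |` X) p' A' /\
    {in b |` X, forall y, B (vsum (b |` X)) (vsum (b |` X)) <= B y y}.
Proof.
move=> [[h1 sX h2] h3 h4 h5] hn hb bX hx hxb.
have xPi : x \in Pi by apply: (fsubsetP sX).
have e1 : 2 * B x b <= - B b b by apply: cartan_le0; rewrite ?simple_root.
have e2 : 2 * B x b <= - B x x.
  by rewrite formC; apply: cartan_le0; rewrite ?simple_root // formC.
have normE : B (vsum (b |` X)) (vsum (b |` X)) =
    B (vsum X) (vsum X) + B b b + 2 * B (vsum X) b.
  by rewrite vsumU1 // !formE (formC B b (vsum X)); ring.
have uniq_nbr y : y \in X -> B y b < 0 -> y = x.
  move=> hy hyb; apply/eqP/negPn/negP => ne.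
  have yPi : y \in Pi by apply: (fsubsetP sX).
  have e3 : 2 * B y b <= - B b b by apply: cartan_le0; rewrite ?simple_root.
  have sY : [fset x; y] `<=` X.
    by apply/fsubsetP => z; rewrite !inE => /orP[]/eqP ->.
  have := form_vsum_le sX hb bX sY.
  have -> : vsum [fset x; y] = x + y.
    by rewrite vsumU1 ?inE 1?eq_sym // /vsum big_seq_fset1.
  rewrite formDl => le; have := hn x hx.
  have : 0 < B (vsum (b |` X)) (vsum (b |` X)).
    apply: norm_gt0; apply/eqP => e; have := @cf_vsum (b |` X) b.
    rewrite e cf0 !inE eqxx => h; have : (0 : R) = 1.
      apply: h => //; apply/fsubsetP => z.
      by rewrite !inE => /orP[/eqP->//|/(fsubsetP sX)].
    by move/eqP; rewrite eq_sym oner_eq0.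
  rewrite normE; lra.
have le : B (vsum X) b <= B x b.
  have := @form_vsum_le X b [fset x] sX hb bX; rewrite /vsum big_seq_fset1.
  by apply; apply/fsubsetP => z; rewrite inE => /eqP ->.
exists (fun a => if a == b then x else p a).
exists (fun a => if a == b then b |` A x else A a).
have bne y : y \in X -> (y == b) = false.
  by move=> hy; apply: contraNF bX => /eqP <-.
have bA y : y \in X -> b \notin A y.
  by move=> /h3[_ /fsubsetP s]; apply: contraNN bX => /s.
split; last first.
  move=> y; rewrite !inE normE => /orP[/eqP ->|hy].
    by have := hn x hx; lra.
  by have := hn y hy; lra.
split.
- rewrite !inE h1 orbT bne //; split=> //.
  by apply/fsubsetP => z; rewrite !inE => /orP[/eqP->//|/(fsubsetP sX)].
- move=> a; rewrite !inE; case: eqP => [-> _|_ /= ha].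
    rewrite !inE eqxx; split=> //; apply: fsetUS; by case: (h3 x hx).
  case: (h3 a ha) => ? s; split=> //; apply: fsubset_trans s _.
  exact: fsubsetUr.
- move=> a; rewrite !inE; case: eqP => [-> _ _|_ /= ha ne].
    by rewrite /= bne // bA // in_fset1U hx orbT.
  by case: (h4 a ha ne) => h41 ? ? ?; rewrite bne // in_fset1U h41 orbT.
- move=> a c; rewrite !inE; case: (eqVneq a b) => [-> _|_ /= ha];
    case: (eqVneq c b) => [-> _|_ /= hc].
  + by move/lt_trans => /(_ _ (root_norm (simple_root hb))); rewrite ltxx.
  + rewrite formC => /(uniq_nbr _ hc) ->; left; split=> //.
    by apply: contraNneq bX => ->.
  + move=> /(uniq_nbr _ ha) ->; right; split=> //.
    by apply: contraNneq bX => ->.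
  + exact: h5.
Qed.

(** Let [t] be the part of [theta] supported outside [X]. If nothing outside [X] were adjacent to
    [X], then [t] would be orthogonal to [theta - t]; it is orthogonal to [theta] because [at0] lies
    in [X]. So [t] would vanish, whereas every coordinate of [theta] is at least 1. *)
Lemma diagram_connected X : at0 \in X -> X `<=` Pi -> X != Pi ->
  exists b x, [/\ b \in Pi, b \notin X, x \in X & B x b < 0].
Proof.
move=> haX sX neX; apply: contrapT => hn.
have orth x b : x \in X -> b \in Pi -> b \notin X -> B x b = 0.
  move=> hx hb hbX; apply/eqP/negPn/negP => h; apply: hn; exists b, x; split=> //.
  apply: simple_adj => //; first exact: (fsubsetP sX).
  by apply: contraNneq hbX => <-.
have [b hb bX] : exists2 b, b \in Pi & b \notin X.
  move: neX; rewrite eqEfsubset sX /= => /fsubsetPn[b hb bX]; by exists b.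
pose t := \sum_(c <- Pi | c \notin X) cf c theta *: c.
have tE : cf b t = cf b theta.
  rewrite /t cf_sum big_mkcond (bigD1_seq b) ?fset_uniq //= bX.
  rewrite cfZ (cf_simple hb hb) eqxx mulr1 big1_seq ?addr0 // => c /andP[ne hc].
  by case: ifP => // _; rewrite cfZ (cf_simple hc hb) eq_sym (negPf ne) mulr0.
have t0 : t = 0.
  apply: (@norm_le0 _ _ B).
  have -> : B t t = B t theta - B t (theta - t) by rewrite formDr formNr; ring.
  have -> : theta - t = \sum_(c <- Pi | c \in X) cf c theta *: c.
    by rewrite {1}[theta]cfE (bigID (mem X)) /= /t addrK.
  have e1 : B t theta = 0.
    rewrite /t form_suml big1_seq // => c /andP[cX hc].
    rewrite formZl formC th_ortho ?mulr0 //.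
    by apply: contraNneq cX => ->.
  have e2 : B t (\sum_(c <- Pi | c \in X) cf c theta *: c) = 0.
    rewrite /t form_suml big1_seq // => c /andP[cX hc].
    rewrite form_sumr big1_seq // => d /andP[dX hd].
    by rewrite formZl formZr formC orth // !mulr0.
  by rewrite e1 e2 subrr.
by have := cf_th_ge1 hb; rewrite -tE t0 cf0; lra.
Qed.

Lemma rooted_tree_exists : exists p A, rooted_tree Pi p A.
Proof.
suff main n X p A : (#|` Pi `\` X| <= n)%N -> rooted_tree X p A ->
    {in X, forall y, B (vsum X) (vsum X) <= B y y} ->
    exists p A, rooted_tree Pi p A.
  apply: (main #|` Pi `\` [fset at0]| [fset at0] id (fun=> [fset at0])) => //.
  - split=> [|a ->|a|a b].
    + by rewrite inE eqxx fsub1set.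
    + by rewrite fsubset_refl.
    + by rewrite inE => ->.
    + rewrite !inE => /eqP -> /eqP ->.
      by move/lt_trans => /(_ _ (root_norm at_root)); rewrite ltxx.
  - by move=> y; rewrite inE => /eqP ->; rewrite /vsum big_seq_fset1.
elim: n X p A => [|n IH] X p A hc hT hn; have [[haX sX _] _ _ _] := hT;
  have [e|ne] := eqVneq X Pi; do ?by exists p, A; rewrite -e.
  have [b [x [hb bX hx hxb]]] := diagram_connected haX sX ne.
  move: hc; rewrite leqn0 cardfs_eq0 => /eqP e.
  by have : b \in Pi `\` X; [rewrite inE bX | rewrite e inE].
have [b [x [hb bX hx hxb]]] := diagram_connected haX sX ne.
have [p' [A' [hT' hn']]] := rooted_tree_grow hT hn hb bX hx hxb.
apply: (IH _ p' A' _ hT' hn').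
rewrite -ltnS; apply: leq_trans hc; apply: fproper_ltn_card.
rewrite fproperE; apply/andP; split.
  by apply/fsubsetP => z; rewrite !inE negb_or -andbA => /and3P[_ -> ->].
by apply/fsubsetPn; exists b; rewrite !inE ?eqxx ?bX.
Qed.

Variables (p : V -> V) (A : V -> {fset V}).
Hypothesis hT : rooted_tree Pi p A.

Lemma anc_at : A at0 = [fset at0].
Proof. by case: hT => -[]. Qed.

Lemma anc_self a : a \in Pi -> a \in A a.
Proof. by case: hT => _ h _ _ /h[]. Qed.

Lemma anc_sub a : a \in Pi -> A a `<=` Pi.
Proof. by case: hT => _ h _ _ /h[]. Qed.

Lemma anc_simple a t : a \in Pi -> t \in A a -> t \in Pi.
Proof. by move=> /anc_sub/fsubsetP h /h. Qed.

Lemma par_simple a : a \in Pi -> a != at0 -> p a \in Pi.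
Proof. by case: hT => _ _ h _ ha /(h a ha)[]. Qed.

Lemma par_adj a : a \in Pi -> a != at0 -> B (p a) a < 0.
Proof. by case: hT => _ _ h _ ha /(h a ha)[]. Qed.

Lemma par_notin a : a \in Pi -> a != at0 -> a \notin A (p a).
Proof. by case: hT => _ _ h _ ha /(h a ha)[]. Qed.

Lemma anc_step a : a \in Pi -> a != at0 -> A a = a |` A (p a).
Proof. by case: hT => _ _ h _ ha /(h a ha)[]. Qed.

Lemma adj_par a b : a \in Pi -> b \in Pi -> B a b < 0 ->
  (a != at0 /\ b = p a) \/ (b != at0 /\ a = p b).
Proof. by case: hT => _ _ _ h; apply: h. Qed.

Lemma card_anc a : a \in Pi -> a != at0 -> #|` A a| = #|` A (p a)|.+1.
Proof. by move=> ha ne; rewrite anc_step // cardfsU1 par_notin. Qed.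

Lemma tree_ind (P : V -> Prop) : P at0 ->
  (forall a, a \in Pi -> a != at0 -> p a \in Pi -> P (p a) -> P a) ->
  forall a, a \in Pi -> P a.
Proof.
move=> h0 IH a ha; have [n] := ubnP #|` A a|.
elim: n a ha => // n IHn a ha; rewrite ltnS => hn.
have [->//|ne] := eqVneq a at0; have pa := par_simple ha ne.
by apply: IH => //; apply: IHn => //; rewrite -card_anc.
Qed.

Lemma at_anc a : a \in Pi -> at0 \in A a.
Proof.
elim/tree_ind: a / => [|a ha ne pa IH]; first by rewrite anc_at inE.
by rewrite anc_step // inE IH orbT.
Qed.

Lemma anc_trans a t : a \in Pi -> t \in A a -> A t `<=` A a.
Proof.
move=> ha; elim/tree_ind: a / ha => [|a ha ne pa IH].
  by rewrite anc_at inE => /eqP ->; rewrite anc_at fsubset_refl.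
rewrite anc_step // inE => /orP[|/IH h].
  by rewrite inE => /eqP ->; rewrite anc_step // fsubset_refl.
exact: fsubset_trans h (fsubsetU1 _ _).
Qed.

Lemma anc_par a t : a \in Pi -> a != at0 -> t \in A (p a) -> t \in A a.
Proof. by move=> ha ne h; rewrite anc_step // inE h orbT. Qed.

Lemma par_anc a : a \in Pi -> a != at0 -> p a \in A a.
Proof. by move=> ha ne; apply: anc_par => //; apply/anc_self/par_simple. Qed.

Lemma anc_anti a t : a \in Pi -> t \in A a -> a \in A t -> t = a.
Proof.
move=> ha ht hat; have tPi := anc_simple ha ht.
have [e|ne] := eqVneq a at0.
  by move: ht; rewrite e anc_at inE => /eqP.
move: ht; rewrite anc_step // !inE => /orP[/eqP//|ht].
have := fsubsetP (anc_trans (par_simple ha ne) ht) _ hat.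
by rewrite (negPf (par_notin ha ne)).
Qed.

Lemma anc_ortho a t : a \in Pi -> a != at0 -> t \in A (p a) -> t != p a ->
  B t a = 0.
Proof.
move=> ha ne ht tp; have pa := par_simple ha ne.
have tPi := anc_simple pa ht.
have ta : t != a by apply: contraNneq (par_notin ha ne) => e; rewrite -{1}e.
apply/eqP/negPn/negP => h; have := simple_adj tPi ha ta h.
case/(adj_par tPi ha) => [[nt e]|[_ e]]; last by rewrite e eqxx in tp.
have hat : a \in A t by rewrite e par_anc.
have /negP := par_notin ha ne; apply.
exact: fsubsetP (anc_trans pa ht) _ hat.
Qed.

(** * Path sums and supports of positive roots *)

Definition pathsum a : V := vsum (A a).

Lemma pathsum_at : pathsum at0 = at0.
Proof. by rewrite /pathsum anc_at /vsum big_seq_fset1. Qed.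

Lemma pathsum_step a : a \in Pi -> a != at0 -> pathsum a = a + pathsum (p a).
Proof. by move=> ha ne; rewrite /pathsum anc_step // vsumU1 ?par_notin. Qed.

Lemma cf_pathsum a b : a \in Pi -> b \in Pi ->
  cf b (pathsum a) = (b \in A a)%:R.
Proof. by move=> ha hb; rewrite cf_vsum // anc_sub. Qed.

Lemma form_pathsum_par a : a \in Pi -> a != at0 ->
  B (pathsum (p a)) a = B (p a) a.
Proof.
move=> ha ne; rewrite /pathsum /vsum form_suml.
rewrite (bigD1_seq (p a)) ?fset_uniq ?anc_self ?par_simple //=.
by rewrite big1_seq ?addr0 // => t /andP[tp ht]; rewrite anc_ortho.
Qed.

Lemma pathsum_D1 a : a \in Pi -> pathsum a \in D1.
Proof.
move=> ha; apply: root_D1; last by rewrite cf_pathsum // at_anc.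
elim/tree_ind: a / ha => [|a ha ne pa IH]; first by rewrite pathsum_at at_root.
have hlt : B a (pathsum (p a)) < 0.
  by rewrite formC form_pathsum_par // par_adj.
rewrite pathsum_step //; apply: (rootD (simple_root ha) IH hlt).
apply/eqP => e; have := cf_pathsum ha ha.
by rewrite pathsum_step // e cf0 anc_self // => /eqP; rewrite eq_sym oner_eq0.
Qed.

Lemma adj_le a b : a \in Pi -> b \in Pi -> B a b < 0 ->
  2 * B a b <= - B b b /\ 2 * B a b <= - B a a.
Proof.
move=> ha hb h; split; first by apply: cartan_le0; rewrite ?simple_root.
by rewrite formC; apply: cartan_le0; rewrite ?simple_root // formC.
Qed.

Lemma adj_long a b : a \in Pi -> b \in Pi -> B a b < 0 -> B b b = N ->
  B a b = - (N / 2).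
Proof.
move=> ha hb h bn; have hN := N_gt0.
have ab : a != b by apply: contraTneq h => ->; rewrite -leNgt norm_ge0.
have ab' : a != - b.
  by apply: contraTneq (simple_pos ha) => ->; apply/posN/simple_pos.
by case: (long_cartan (simple_root ha) (simple_root hb) bn ab ab') => e;
  move: h; rewrite e => ?; lra.
Qed.

(** Appending [a] changes the norm by [B a a + 2 * B (p a) a], which is at most 0 and at most
    [B a a - B (p a) (p a)]. *)
Lemma pathsum_norm a t : a \in Pi -> t \in A a ->
  B (pathsum a) (pathsum a) <= B t t.
Proof.
move=> ha; elim/tree_ind: a / ha t => [|a ha ne pa IH] t.
  by rewrite anc_at pathsum_at inE => /eqP ->.
have [e1 e2] := adj_le pa ha (par_adj ha ne).
rewrite anc_step // pathsum_step // !formE (formC B a (pathsum (p a))).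
rewrite form_pathsum_par // !inE => /orP[/eqP ->|/IH h]; last by lra.
by have := IH (p a) (anc_self pa); lra.
Qed.

(** The end [at0] contributes [N], its only neighbour on the path contributes [- (N / 2)], and all
    other nodes contribute 0. *)
Lemma pathsum_at_pair a : a \in Pi -> a != at0 -> B (pathsum a) at0 = N / 2.
Proof.
move=> ha; elim/tree_ind: a / ha => [|a ha ne pa IH _]; first by rewrite eqxx.
have hN := N_gt0; rewrite pathsum_step // formDl.
have [e|pne] := eqVneq (p a) at0; last first.
  rewrite IH //; suff -> : B a at0 = 0 by rewrite add0r.
  by rewrite formC anc_ortho ?at_anc // eq_sym.
rewrite e pathsum_at at_norm adj_long ?at_norm //; first by lra.
by rewrite formC -e par_adj.
Qed.

Lemma pathsum_at_ge a : a \in Pi -> N / 2 <= B (pathsum a) at0.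
Proof.
move=> ha; have hN := N_gt0; have [->|ne] := eqVneq a at0.
  by rewrite pathsum_at at_norm; lra.
by rewrite pathsum_at_pair.
Qed.

(* If [a] is long and its parent short, then [2 * pathsum (p a) + a - theta]
   has norm at most 0; the resulting identity contradicts the pairing with
   [at0]. *)
Lemma par_long a : a \in Pi -> a != at0 -> B a a = N -> B (p a) (p a) = N.
Proof.
move=> ha ne an; have hN := N_gt0.
have pa := par_simple ha ne; apply: contrapT => hn.
have pl : B (p a) (p a) < N.
  rewrite lt_neqAle th_long ?simple_root // andbT; exact/eqP.
have ppos := root_norm (simple_root pa).
have hadj := par_adj ha ne.
have e1 : B (p a) a = - (N / 2) by apply: adj_long.
(* The product of the Cartan integer of [a] at [p a] with the norm of [p a] is [- N]; as [p a] is
   short, the integer is not -1, so it is at most -2. *)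
have e2 : B (p a) (p a) <= N / 2.
  have adj' : B a (p a) < 0 by rewrite formC.
  have := cartanM B a (root_neq0 (simple_root pa)).
  rewrite (formC B a) e1.
  by case: (cartan_lt0 (simple_root ha) (simple_root pa) adj') => [->|h] h2; nra.
have paat : p a != at0 by apply: contraTneq pl => ->; rewrite at_norm ltxx.
pose y := pathsum (p a).
have yn : B y y <= N / 2 := le_trans (pathsum_norm pa (anc_self pa)) e2.
have ya : B y a = - (N / 2) by rewrite /y form_pathsum_par.
have yt : B y theta = N / 2 by rewrite D1_th // pathsum_D1.
have at_a : B a theta = 0 by rewrite formC th_ortho.
have z0 : 2 *: y + a - theta = 0.
  apply: (@norm_le0 _ _ B).
  rewrite !formE (formC B a y) (formC B theta y) (formC B theta a).
  rewrite an ya yt at_a; lra.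
have : B (2 *: y + a - theta) at0 = 0 by rewrite z0 form0l.
rewrite !formE th_at at_norm pathsum_at_pair //.
have -> : B a at0 = 0 by rewrite formC anc_ortho ?at_anc // eq_sym.
lra.
Qed.

Lemma pathsum_long a : a \in Pi -> B a a = N -> B (pathsum a) (pathsum a) = N.
Proof.
move=> ha; elim/tree_ind: a / ha => [|a ha ne pa IH] an.
  by rewrite pathsum_at.
have pn := par_long ha ne an.
rewrite pathsum_step // !formE (formC B a (pathsum (p a))).
rewrite form_pathsum_par // IH // an (adj_long pa ha) ?par_adj //.
by field.
Qed.

(** This is the connectedness of the support of a positive root. Subtract a simple root [b] that
    pairs positively with [g]. If [b] were on the other side than the support of [g - b], it would
    be orthogonal to [g - b], and reflecting [g] in [b] would give a positive root with coordinate
    -1 at [b]. *)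
Lemma support_split g (P : V -> bool) : g \in Dp ->
  {in Pi &, forall a b, cf a g != 0 -> cf b g != 0 -> P a != P b -> B a b = 0} ->
  exists c : bool, {in Pi, forall b, cf b g != 0 -> P b = c}.
Proof.
elim/pos_ind: g / => g hg IH hP.
have [b hb gb] := pos_descent hg.
have [e|ne] := eqVneq g b.
  exists (P b) => a ha; rewrite e cf_simple //.
  by have [->|] := eqVneq a b; rewrite // eqxx.
have hr := pos_subr hg hb ne gb.
have le : rle Pi (g - b) g.
  apply/rleP => a ha; exists (a == b : nat).
  by rewrite cfB (cf_simple hb ha); ring.
have supp a : a \in Pi -> cf a (g - b) != 0 -> cf a g != 0.
  move=> ha h; have := rle_cf le ha; have := pos_cf_ge1 hr ha h.
  by move=> h1 h2; apply/eqP => e; move: h1 h2; rewrite e; lra.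
have b0 := root_neq0 (simple_root hb).
have nb : g - b != g by rewrite -subr_eq0 addrAC subrr sub0r oppr_eq0.
have [c hc] : exists c : bool, {in Pi, forall a, cf a (g - b) != 0 -> P a = c}.
  apply: IH => // a1 a2 h1 h2 h3 h4; apply: hP => //; exact: supp.
have bg : cf b g != 0.
  have := pos_cf_ge0 hr hb; rewrite cfB (cf_simple hb hb) eqxx => h.
  by apply/eqP => e; move: h; rewrite e mulr1n; lra.
have [Pb|Pb] := eqVneq (P b) c.
  exists c => a ha h; have [->//|ab] := eqVneq a b.
  by apply: hc => //; rewrite cfB (cf_simple hb ha) (negPf ab) subr0.
have o : B (g - b) b = 0.
  rewrite formcf big1_seq // => a /andP[_ ha].
  have [->|h] := eqVneq (cf a (g - b)) 0; first by rewrite mul0r.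
  suff -> : B a b = 0 by rewrite mulr0.
  by apply: hP => //; [apply: supp | rewrite (hc a ha h) eq_sym].
have : refl B b g \in Dp by apply: refl_pos.
have -> : refl B b g = g - b - b.
  by rewrite -{1}[g](subrK b) reflD refl_ortho // reflxx.
move/pos_cf_ge0 => /(_ b hb).
rewrite cfB; have -> : cf b (g - b) = 0.
  apply/eqP/negPn/negP => h; by rewrite (hc b hb h) eqxx in Pb.
by rewrite (cf_simple hb hb) eqxx mulr1n; lra.
Qed.

(** The property that all ancestors of a node lie in the support takes the same value at adjacent
    nodes of the support, so [support_split] makes it constant there; it holds at [at0]. *)
Lemma support_anc g a t : g \in Dp -> cf at0 g != 0 -> a \in Pi ->
  cf a g != 0 -> t \in A a -> cf t g != 0.
Proof.
move=> hg h0 ha hag ht; pose P u := all (fun v => cf v g != 0) (A u).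
have step u : u \in Pi -> u != at0 -> P u = (cf u g != 0) && P (p u).
  move=> hu ne; rewrite /P anc_step //; apply/allP/andP => [h|[h1 /allP h2] v].
    split; first by apply: h; rewrite !inE eqxx.
    by apply/allP => v hv; apply: h; rewrite !inE hv orbT.
  by rewrite !inE => /orP[/eqP ->|/h2].
have [c hc] : exists c : bool, {in Pi, forall b, cf b g != 0 -> P b = c}.
  apply: support_split => // u v hu hv h1 h2 ne.
  have uv : u != v by apply: contraNneq ne => ->.
  apply/eqP/negPn/negP => h; have := simple_adj hu hv uv h.
  case/(adj_par hu hv) => -[n e].
    by move: ne; rewrite (step u) // h1 e eqxx.
  by move: ne; rewrite (step v) // h2 e eqxx.
have Pat : P at0 by rewrite /P anc_at; apply/allP => v; rewrite inE => /eqP ->.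
have : P a by rewrite (hc a ha hag) -(hc at0 hat0 h0).
by move/allP => /(_ _ ht).
Qed.

Lemma rle_pathsum a t : a \in Pi -> t \in A a -> rle Pi (pathsum t) (pathsum a).
Proof.
move=> ha ht; apply/rleP => b hb; have tPi := anc_simple ha ht.
rewrite !cf_pathsum //; have := fsubsetP (anc_trans ha ht) b.
case: (b \in A t) => [/(_ isT) ->|_]; first by exists 0%N; rewrite subrr.
by exists (b \in A a : nat); rewrite subr0.
Qed.

(** The coordinates of [g] are 0 or 1 and its support is closed under ancestors. If the support
    misses [a], the bound descends to the parent; otherwise it is the whole path. *)
Lemma D1_le_pathsum a g : a \in Pi -> g \in D1 -> rle Pi g (pathsum a) ->
  exists2 t, t \in A a & g = pathsum t.
Proof.
move=> ha hg; have hgp := D1_pos hg.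
have hg0 : cf at0 g != 0 by rewrite D1_cf // oner_eq0.
elim/tree_ind: a / ha => [|a ha ne pa IH] le.
  exists at0; first by rewrite anc_at inE.
  apply: rle_anti => //; apply/rleP => b hb; rewrite cf_pathsum // anc_at inE.
  exists 0%N; have := rle_cf le hb; rewrite cf_pathsum // anc_at inE.
  have [->|_] := eqVneq b at0; first by rewrite D1_cf // subrr.
  by have := pos_cf_ge0 hgp hb; rewrite mulr0n; lra.
have [e|h] := eqVneq (cf a g) 0.
  have [|t ht ->] := IH; last by exists t => //; apply: anc_par.
  apply/rleP => b hb; have := rleP _ _ le b hb; rewrite !cf_pathsum //.
  rewrite anc_step // !inE; have [->|//] := eqVneq b a.
  by move=> _; exists 0%N; rewrite e (negPf (par_notin ha ne)) subr0.
exists a; first exact: anc_self.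
apply: rle_anti => //; apply/rleP => b hb; exists 0%N.
have := rle_cf le hb; rewrite !cf_pathsum //; case hba: (b \in A a) => le1.
  have := pos_cf_ge1 hgp hb (support_anc hgp hg0 ha h hba).
  by move: le1; rewrite mulr1n; lra.
by have := pos_cf_ge0 hgp hb; move: le1; rewrite mulr0n; lra.
Qed.

(** * Ideals and rootlets *)

Lemma mem_ideal_ge x g : (g \in ideal_ge Delta Pi x) = (g \in Dp) && rle Pi x g.
Proof. by rewrite !inE. Qed.

Lemma rle_subC x y z : rle Pi (x - y) z = rle Pi (x - z) y.
Proof. by rewrite /rle; congr (`[< nncomb Pi _ >]); rewrite !opprB addrCA. Qed.

Lemma ideal_pathsumP a g : a \in Pi ->
  (g \in ideal_ge Delta Pi (theta - pathsum a)) <->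
  (g = theta \/ exists2 t, t \in A a & g = theta - pathsum t).
Proof.
move=> ha; have hD := D1_compl (pathsum_D1 ha); split.
  rewrite mem_ideal_ge => /andP[hg le].
  have [->|ne] := eqVneq g theta; first by left.
  right; have gD : g \in D1.
    apply: root_D1; first exact: pos_root.
    case: (pos_cf01 hg ne) => // e; have := rle_cf le hat0.
    by rewrite e (D1_cf hD) ler10.
  have [|t ht e] := D1_le_pathsum ha (D1_compl gD); first by rewrite -rle_subC.
  by exists t => //; rewrite -e subKr.
rewrite mem_ideal_ge => -[->|[t ht ->]].
  by rewrite th_pos th_max // D1_pos.
have tPi := anc_simple ha ht.
rewrite (D1_pos (D1_compl (pathsum_D1 tPi))) rle_subC subKr.
exact: rle_pathsum.
Qed.

Lemma upper_ideal_ge x : upper_ideal Delta Pi (ideal_ge Delta Pi x).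
Proof.
split=> [|g a]; first by apply/fsubsetP => g; rewrite mem_ideal_ge => /andP[].
rewrite !mem_ideal_ge => /andP[_ h1] -> h2.
exact: rle_trans h1 h2.
Qed.

Lemma D1_add_pos x y : x \in D1 -> y \in D1 -> x + y \in Dp -> x + y = theta.
Proof.
move=> hx hy hp; apply/eqP/negPn/negP => /(pos_cf01 hp).
by rewrite cfD !D1_cf //; case; lra.
Qed.

Lemma th_add_notpos x : x \in Dp -> theta + x \notin Dp.
Proof.
move=> hx; apply/negP => hp.
have ne : theta + x != theta.
  by rewrite -subr_eq0 addrAC subrr add0r root_neq0 // pos_root.
have := pos_cf_ge0 hx hat0.
by case: (pos_cf01 hp ne); rewrite cfD cf_th; lra.
Qed.

(* [theta] is not a sum of two path sums: each pairs with [at0] to at least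
   [N / 2], while [theta] pairs to [N / 2]. *)
Lemma ideal_pathsum_abelian a : a \in Pi ->
  abelian_ideal Delta Pi (ideal_ge Delta Pi (theta - pathsum a)).
Proof.
move=> ha; split; first exact: upper_ideal_ge.
move=> x y /(ideal_pathsumP _ ha) hx /(ideal_pathsumP _ ha) hy.
case: hx => [->|[t ht ->]].
  apply: th_add_notpos; case: hy => [->|[s /(anc_simple ha) hs ->]].
    exact: th_pos.
  exact: D1_pos (D1_compl (pathsum_D1 hs)).
have tPi := anc_simple ha ht.
case: hy => [->|[s /(anc_simple ha) hs ->]].
  by rewrite addrC; apply: th_add_notpos (D1_pos (D1_compl (pathsum_D1 tPi))).
apply/negP => /(D1_add_pos (D1_compl (pathsum_D1 tPi)) (D1_compl (pathsum_D1 hs))).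
move=> e; have : B (theta - pathsum t + (theta - pathsum s)) at0 = B theta at0.
  by rewrite e.
rewrite !formE th_at at_norm; have := N_gt0.
have := pathsum_at_ge tPi; have := pathsum_at_ge hs; lra.
Qed.

Lemma ideal_theta : ideal_ge Delta Pi theta = [fset theta].
Proof.
apply/fsetP => g; rewrite mem_ideal_ge inE; apply/andP/eqP => [[hg h]|->].
  by apply: rle_anti => //; apply: th_max.
by rewrite th_pos rle_refl.
Qed.

Lemma ideal_theta_abelian :
  abelian_ideal Delta Pi (ideal_ge Delta Pi theta).
Proof.
split; first exact: upper_ideal_ge.
move=> x y; rewrite ideal_theta !in_fset1 => /eqP -> /eqP ->.
exact: th_add_notpos th_pos.
Qed.

(** * Affine Weyl group elements as isometries with an integral linear form *)

Record affine_action (w : V * R -> V * R) (u : V -> V) (l : V -> R) : Prop :=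
  AffineAction {
    actE : forall x t, w (x, t) = (u x, t + l x);
    act_uD : forall x y, u (x + y) = u x + u y;
    act_uZ : forall c x, u (c *: x) = c *: u x;
    act_lD : forall x y, l (x + y) = l x + l y;
    act_lZ : forall (c : R) x, l (c *: x) = c * l x;
    act_iso : forall x y, B (u x) (u y) = B x y;
    act_root : forall g, g \in Delta -> u g \in Delta;
    act_int : forall g, g \in Delta -> exists k : int, l g = k%:~R }.

Lemma affine_weyl_action w : affine_weyl B Delta w ->
  exists u l, affine_action w u l.
Proof.
elim=> {w} [|a k w ha _ [u [l [h1 h2 h3 h4 h5 h6 h7 h8]]]].
  exists id, (fun=> 0); split=> //.
  - by move=> x t; rewrite addr0.
  - by move=> x y; rewrite addr0.
  - by move=> c x; rewrite mulr0.
  - by move=> g _; exists 0.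
exists (refl B a \o u), (fun x => l x - k%:~R * cartan B (u x) a).
split=> [x t|x y|c x|x y|c x|x y|g hg|g hg] /=.
- by rewrite h1 /affine_refl /= addrA.
- by rewrite h2 reflD.
- by rewrite h3 reflZ.
- by rewrite h2 h4 cartanDl; ring.
- by rewrite h3 h5 cartanZl; ring.
- by rewrite form_refl ?h6 // root_neq0.
- by apply: root_refl => //; apply: h7.
have [m ->] := h8 g hg; have [n ->] := cartan_int (h7 g hg) ha.
by exists (m - k * n); rewrite intrB intrM.
Qed.

Section Action.

Variables (w : V * R -> V * R) (u : V -> V) (l : V -> R).
Hypothesis hw : affine_action w u l.

Lemma act_uN x : u (- x) = - u x.
Proof. by rewrite -scaleN1r (act_uZ hw) scaleN1r. Qed.

Lemma act_lN x : l (- x) = - l x.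
Proof. by rewrite -scaleN1r (act_lZ hw) mulN1r. Qed.

Lemma act_inj : injective u.
Proof.
move=> x y e; apply/eqP; rewrite -subr_eq0; apply/eqP/(@norm_le0 _ _ B).
by rewrite -(act_iso hw) (act_uD hw) act_uN e subrr form0l.
Qed.

Lemma act_l_sum (r : seq V) (F : V -> V) :
  l (\sum_(g <- r) F g) = \sum_(g <- r) l (F g).
Proof.
apply: (big_morph _ (act_lD hw)).
by rewrite -[0](scale0r 0) (act_lZ hw) mul0r.
Qed.

End Action.

Lemma affine_positiveE x (k : int) : x \in Delta ->
  affine_positive Delta Pi (x, k%:~R) <-> (1 <= k) || (k == 0) && (x \in Dp).
Proof.
move=> hx; split=> [[a [m [[-> /intr_inj ->] []]]] /andP[h1 h2]|h].
- by rewrite h1.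
- by rewrite h1 h2 orbT.
by exists x, k; split=> //; rewrite hx andbT; case/orP: h => [->|h]; [left|right].
Qed.

Lemma inversionE w u l (x : V) (k m : int) : affine_action w u l ->
  x \in Delta -> l x = m%:~R ->
  inversion Delta Pi w (x, k%:~R) <->
  ((1 <= k) || (k == 0) && (x \in Dp)) /\
  ((1 <= - (k + m)) || (k + m == 0) && (- u x \in Dp)).
Proof.
move=> hw hx hm; rewrite /inversion (actE hw) hm.
have -> : - (u x, k%:~R + m%:~R) = (- u x, (- (k + m))%:~R) :> V * R.
  by rewrite mulrNz mulrzDr.
by rewrite !affine_positiveE ?rootN ?(act_root hw) // oppr_eq0.
Qed.

(* Neither [g] nor [2 delta - g] is inverted, which leaves only four
   combinations of the level [l g] and the sign of [u g]. *)
Lemma mem_ideal_level w u l (J : {fset V}) g : affine_action w u l ->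
  (forall x : V * R, inversion Delta Pi w x <-> exists2 a, a \in J & x = (- a, 1)) ->
  g \in Dp ->
  (g \in J)%:R = l g - 1 / 2 + (if u g \in Dp then 1 else - 1) / 2.
Proof.
move=> hw hJ hg; have gr := pos_root hg.
have [m hm] := act_int hw gr.
have hmN : l (- g) = (- m)%:~R by rewrite (act_lN hw) hm rmorphN.
have h0 : ~ inversion Delta Pi w (g, 0%:~R).
  by move/hJ => [a _ [_ /eqP]]; rewrite eq_sym oner_eq0.
have h2 : ~ inversion Delta Pi w (- g, 2%:~R).
  by move/hJ => [a _ [_ /eqP]]; rewrite -(subr_eq0 _ 1); move/eqP => /=; lra.
have h1 : inversion Delta Pi w (- g, 1%:~R) <-> g \in J.
  rewrite hJ; split=> [[a ha [/oppr_inj ->]]|h] //; by exists g.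
move: h0 h1 h2; rewrite !inversionE ?rootN ?(act_root hw) //; try eassumption.
rewrite (act_uN hw) opprK hg hm; set P := u g \in Dp.
have nP : (- u g \in Dp) = ~~ P.
  apply/idP/idP => [/posN|]; first by rewrite opprK.
  by rewrite /P; case: (pos_or_neg (act_root hw gr)) => // ->.
rewrite nP => h0 h1 h2.
have {}h0 : ~~ ((1 <= - (0 + m)) || (0 + m == 0) && ~~ P).
  by apply/negP => h; apply: h0.
have {}h2 : ~~ ((1 <= - (2 - m)) || (2 - m == 0) && P).
  by apply/negP => h; apply: h2.
have {h1} : ((1 <= - (1 - m)) || (1 - m == 0) && P) = (g \in J).
  by apply/idP/idP => [h|/h1[]//]; apply/h1.
move: h0 h2; case: P {nP}; case: (g \in J) => /= h0 h2 h1.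
- have -> : m = 1 by lia.
  by rewrite mulr1z; lra.
- have -> : m = 0 by lia.
  by rewrite mulr0z; lra.
- have -> : m = 2 by lia.
  by rewrite -[2%:~R]/(2%:R); lra.
- have -> : m = 1 by lia.
  by rewrite mulr1z; lra.
Qed.

(** * Counting the elements of an abelian ideal that are not orthogonal to the highest root *)

Lemma form_th_sum (c : V -> R) :
  \sum_(g <- Dp) c g * cf at0 g = 2 / N * \sum_(g <- Dp) c g * B g theta.
Proof.
rewrite mulr_sumr; apply: eq_bigr => g _; rewrite (form_th g).
by field; rewrite gt_eqF ?N_gt0.
Qed.

Lemma cf_sum_pos : \sum_(g <- Dp) cf at0 g = 2 / N * hsum theta.
Proof.
have := form_th_sum (fun=> 1); under eq_bigr => g _ do rewrite mul1r.
by move=> ->; congr (_ * _); apply: eq_bigr => g _; rewrite mul1r.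
Qed.

(* Reflecting in [theta] pairs [g] with [theta - g] inside [D1]. *)
Lemma cf_scaled_sum : \sum_(g <- Dp) cf at0 g *: g =
  ((\sum_(g <- Dp) cf at0 g + 2) / 2) *: theta.
Proof.
pose f g := if g == theta then g else if cf at0 g == 1 then theta - g else g.
have cff g : g \in Dp -> cf at0 (f g) = cf at0 g.
  move=> hg; rewrite /f; case: eqP => // _; case: eqP => // e.
  by rewrite cfB cf_th e; lra.
have f1 g : g \in D1 -> f g = theta - g.
  by move=> hg; rewrite /f (negPf (D1_neq_th hg)) D1_cf // eqxx.
have ff g : g \in Dp -> f (f g) = g.
  move=> hg; have [e|ne] := boolP (g \in D1).
    by rewrite (f1 g) // f1 ?D1_compl // subKr.
  suff e : f g = g by rewrite !e.
  by move: ne; rewrite mem_D1 hg /f /= => /negPf ->; rewrite if_same.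
have pf : perm_eq (map f Dp) Dp.
  apply: perm_map_self => [g hg|g g' hg hg' e]; last by rewrite -(ff g) // e ff.
  rewrite /f; case: eqP => // _; case: eqP => // e.
  by apply/D1_pos/D1_compl; rewrite mem_D1 hg e eqxx.
pose S := \sum_(g <- Dp) cf at0 g *: g.
have S2 : S + S = (\sum_(g <- Dp) cf at0 g + 2) *: theta.
  rewrite {2}/S -(perm_big _ pf) big_map /S -big_split /=.
  (* In [S + S], a root of [D1] and its complement add up to [theta], but [f] fixes [theta], which
     contributes 4 rather than its coordinate 2. Hence the correction 2 at [theta]. *)
  have -> : (2 : R) = \sum_(g <- Dp) (if g == theta then 2 else 0).
    rewrite (bigD1_seq theta) ?fset_uniq ?th_pos //= eqxx big1 ?addr0 // => g.
    by move=> /negPf ->.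
  rewrite -big_split scaler_suml; apply: eq_big_seq => g hg /=.
  rewrite cff // /f; case: eqP => [->|/eqP ne].
    by rewrite cf_th -scalerDl.
  case: (pos_cf01 hg ne) => ->.
    by rewrite eq_sym oner_eq0 !scale0r !addr0 scale0r.
  by rewrite eqxx addr0 !scale1r addrC subrK.
have e : S = 2^-1 *: (S + S).
  by rewrite -mulr2n -[S *+ 2]scaler_nat scalerA mulVf ?scale1r ?pnatr_eq0.
by rewrite -/S e S2 scalerA; congr (_ *: _); ring.
Qed.

(** The rootlet condition says that [l theta = 2] and [u theta = - a]. Weight the formula of
    [mem_ideal_level] by [cf at0 g] and sum over the positive roots: the left side counts [theta]
    twice and each element of [D1] once. On the right, [cf_scaled_sum] evaluates the part with [l]
    from [l theta], and the part with the signs from [u theta]. *)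
Lemma ideal_count (J : {fset V}) a : has_rootlet B Delta Pi theta J a ->
  a \in Dp -> (#|` J `&` D1|)%:R = hsum (theta - a) / N.
Proof.
move=> [[[/fsubsetP sJ _] _] _ [w [/affine_weyl_action[u [l hw]] hJ]]] hwa ha.
have hN := N_gt0; move: hwa; rewrite (actE hw) (act_uN hw) (act_lN hw) => -[eu el].
have lth : l theta = 2.
  by apply/eqP; rewrite eq_sym -subr_eq0; apply/eqP.
have uth : u theta = - a by rewrite -eu opprK.
have lev g : g \in Dp -> _ := mem_ideal_level hw hJ.
have hth : theta \in J.
  have := lev theta th_pos; rewrite lth uth (negPf (posN ha)).
  by case: (theta \in J) => //; rewrite mulr0n; lra.
pose s g : R := if u g \in Dp then 1 else -1.
pose f g := if u g \in Dp then u g else - u g.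
have pf : perm_eq (map f Dp) Dp.
  apply: perm_map_self => [g hg|g g' hg hg'].
    rewrite /f; case: ifP => // h.
    by case: (pos_or_neg (act_root hw (pos_root hg))) => //; rewrite h.
  rewrite /f; case: ifP => _; case: ifP => _.
  - exact: act_inj hw _ _.
  - rewrite -(act_uN hw) => /(act_inj hw) e.
    by move: (posN hg'); rewrite -e hg.
  - rewrite -(act_uN hw) => /(act_inj hw) e.
    by move: (posN hg); rewrite e hg'.
  - by move/oppr_inj/(act_inj hw).
(* Up to the sign [s g], the isometry [u] permutes the positive roots, so the signed sum of pairings
   with [theta] becomes the plain sum of pairings with [u theta]. *)
have es : \sum_(g <- Dp) s g * B g theta = - hsum a.
  rewrite -hsumN -uth /hsum -[RHS](perm_big _ pf) big_map.
  apply: eq_bigr => g _; rewrite /s /f; case: ifP => _.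
    by rewrite mul1r (act_iso hw).
  by rewrite formNl (act_iso hw) mulN1r.
have e1 : \sum_(g <- J) cf at0 g = 2 + (#|` J `&` D1|)%:R.
  rewrite (bigD1_seq theta) ?fset_uniq //= cf_th; congr (_ + _).
  have -> : #|` J `&` D1| = \sum_(g <- J | g \in D1) 1.
    rewrite sum1_count -size_filter; apply: perm_size.
    apply: uniq_perm; rewrite ?filter_uniq ?fset_uniq // => g.
    by rewrite mem_filter in_fsetI andbC.
  rewrite natr_sum [RHS]big_mkcond [LHS]big_mkcond /=; apply: eq_big_seq => g hg.
  have [->|ne] := eqVneq g theta; last first.
    case: (pos_cf01 (sJ _ hg) ne) => e; rewrite mem_D1 (sJ _ hg) e ?eqxx //.
    by rewrite eq_sym oner_eq0.
  by rewrite mem_D1 cf_th (eqr_nat _ 2 1) andbF.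
have e2 : \sum_(g <- J) cf at0 g = \sum_(g <- Dp) (g \in J)%:R * cf at0 g.
  have hp : perm_eq [seq g <- Dp | g \in J] J.
    apply: uniq_perm; rewrite ?filter_uniq ?fset_uniq // => g.
    by rewrite mem_filter andb_idr // => /sJ.
  rewrite -(perm_big _ hp) big_filter big_mkcond; apply: eq_bigr => g _.
  by case: ifP => _; rewrite ?mul1r ?mul0r.
have e3 : \sum_(g <- Dp) (g \in J)%:R * cf at0 g =
    l (\sum_(g <- Dp) cf at0 g *: g) - (\sum_(g <- Dp) cf at0 g) / 2
    + (\sum_(g <- Dp) s g * cf at0 g) / 2.
  rewrite (act_l_sum hw) !mulr_suml -sumrB -big_split /=.
  apply: eq_big_seq => g hg; rewrite lev // (act_lZ hw) /s.
  by case: ifP => _; field.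
have := e1; rewrite e2 e3 cf_scaled_sum (act_lZ hw) lth form_th_sum es cf_sum_pos.
rewrite hsumB.
have -> : 2 / N * - hsum a / 2 = - (hsum a / N) by field; rewrite gt_eqF.
have -> : (2 / N * hsum theta + 2) / 2 * 2 = 2 * (hsum theta / N) + 2.
  by field; rewrite gt_eqF.
have -> : 2 / N * hsum theta / 2 = hsum theta / N by field; rewrite gt_eqF.
by rewrite mulrBl; lra.
Qed.

(** * Path sums give amazing roots *)

Lemma affine_reflN_theta x t :
  affine_refl B (- theta) 1 (x, t) = (refl B theta x, t + cf at0 x).
Proof.
rewrite /affine_refl /= reflNl cartanNr mul1r opprK; congr (_, _ + _).
by rewrite /cartan form_th; field; rewrite gt_eqF ?N_gt0.
Qed.

(** Here [w] is the reflection in [delta - theta] followed by a finite part [u] inverting exactly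
    [K]. For [g] in [D1] the first reflection sends [delta - g] to [theta - g] at level 0, so [K]
    decides whether [delta - g] is inverted. *)
Lemma peterson_level w (u : V -> V) (K J : {fset V}) : affine_weyl B Delta w ->
  (forall x t, w (x, t) = (u (refl B theta x), t + cf at0 x)) ->
  (forall x, u (- x) = - u x) -> u theta \in Dp -> K `<=` D1 ->
  {in Dp, forall g, (u g \notin Dp) = (g \in K)} ->
  (forall g, g \in J <-> g = theta \/ (g \in D1 /\ theta - g \in K)) ->
  peterson B Delta Pi J w.
Proof.
move=> hw wE uN uth sK hK hJ; split=> // -[x s].
have [u' [l' ha]] := affine_weyl_action hw.
have e y : u' y = u (refl B theta y) /\ l' y = cf at0 y.
  by have := wE y 0; rewrite (actE ha) => -[-> /addrI ->].
have uroot g : g \in Delta -> u (refl B theta g) \in Delta.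
  by move=> hg; have [<- _] := e g; apply: act_root ha _ hg.
have urefl g : g \in D1 -> u (refl B theta g) = - u (theta - g).
  by move=> hg; rewrite D1_refl_th // -uN opprB.
have uthN : - u (refl B theta theta) = u theta.
  by rewrite reflxx ?th_neq0 // uN opprK.
have uD1 g : g \in D1 -> (u (refl B theta g) \in Dp) = (theta - g \in K).
  move=> hg; rewrite -(hK _ (D1_pos (D1_compl hg))) (urefl g hg).
  have := uroot g (D1_root hg); rewrite (urefl g hg) rootNE => hr.
  apply/idP/idP => [h|h]; first by rewrite -[u _]opprK posN.
  by case: (pos_or_neg hr) => //; rewrite (negPf h).
split=> [hinv|[g /hJ hg [-> ->]]]; last first.
  have gr : g \in Delta by case: hg => [->|[/D1_root//]]; apply: th_root.
  have [e1 e2] := e (- g); case: hg => [eg|[gD gK]].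
    have h : l' (- g) = (-2)%:~R by rewrite e2 cfN eg cf_th.
    by rewrite -[1]/(1%:~R) (inversionE _ ha _ h) ?rootN.
  have h : l' (- g) = (-1)%:~R by rewrite e2 cfN D1_cf.
  rewrite -[1]/(1%:~R) (inversionE _ ha _ h) ?rootN //; split=> //=.
  by rewrite e1 reflN uN opprK uD1.
have [[y [k [[ex es] hyk]]] _] := hinv; subst x s.
have yr : y \in Delta.
  by case: hyk => /andP[_] //; apply: pos_root.
have [e1 e2] := e y.
case: (pos_or_neg yr) => hy.
  (* For positive [y] the level does not drop, so an inversion has [k = m = 0]; then [y] is
     orthogonal to [theta] and inverted by [u], against the inclusion of [K] in [D1]. *)
  have [m hm] := pos_cf hy hat0.
  have h : l' y = (m%:Z)%:~R by rewrite e2 hm.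
  move: hinv; rewrite (inversionE _ ha yr h) hy andbT e1 => -[h1 h2].
  have [k0 m0] : k = 0 /\ m = 0%N by lia.
  move: h2; rewrite k0 m0 /= => h2.
  have o : B y theta = 0 by rewrite form_th hm m0 !mul0r.
  have : y \in K by rewrite -hK // -(refl_ortho o) -[u _]opprK posN.
  move/(fsubsetP sK)/D1_cf; rewrite hm m0 => /eqP.
  by rewrite eq_sym oner_eq0.
have [g gE] : exists g, y = - g by exists (- y); rewrite opprK.
subst y; rewrite opprK in hy; have hg := pos_root hy.
have [m hm] := pos_cf hy hat0.
have h : l' (- g) = (- m%:Z)%:~R by rewrite e2 cfN hm rmorphN.
move: hinv; rewrite (inversionE _ ha yr h) (negPf (posN hy)) andbF orbF e1.
rewrite reflN uN opprK => -[h1 h2].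
(* The level drops from [k] to [k - m], where [m] is 2 for [theta] and 0 or 1 otherwise. Drop 0 is
   impossible, drop 1 forces [k = 1], and for [theta] the value [k = 2] is excluded because
   [u theta] is positive. *)
have [eg|ne] := eqVneq g theta.
  have m2 : m = 2%N by apply/eqP; rewrite -(eqr_nat R) -hm eg cf_th.
  have k1 : k = 1.
    have : (k == 1) || (k == 2) by move: h1 h2; rewrite m2; clear; lia.
    case/orP => /eqP // k2; move: h2; rewrite k2 m2 /= eg => h2.
    by have := posN uth; rewrite -uthN opprK h2.
  by exists g; [apply/hJ; left|rewrite k1].
case: (pos_cf01 hy ne) => e3.
  have m0 : m = 0%N by apply/eqP; rewrite -(eqr_nat R) -hm e3.
  by exfalso; move: h1 h2; rewrite m0 addr0 => /=; clear; lia.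
have m1 : m = 1%N by apply/eqP; rewrite -(eqr_nat R) -hm e3.
have gD : g \in D1 by rewrite mem_D1 hy e3 eqxx.
have k1 : k = 1 by move: h1 h2; rewrite m1; clear; lia.
exists g; last by rewrite k1.
by apply/hJ; right; split=> //; rewrite -uD1 //; move: h2; rewrite k1 m1.
Qed.

(** Properties of the reflection in [delta - theta] followed by the simple reflections along the
    path from [at0] to [a]. The last three fields serve the induction: for a child [b] of [a] they
    give [u (pathsum b) = b], so [pathsum b] is the inversion added by the next reflection. *)
Record path_word (a : V) (w : V * R -> V * R) (u : V -> V) : Prop :=
  PathWord {
    pw_weyl : affine_weyl B Delta w;
    pw_E : forall x t, w (x, t) = (u (refl B theta x), t + cf at0 x);
    pw_D : forall x y, u (x + y) = u x + u y;
    pw_N : forall x, u (- x) = - u x;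
    pw_inj : injective u;
    pw_root : forall g, g \in Delta -> u g \in Delta;
    pw_th : u theta = theta - pathsum a;
    pw_inv : {in Dp, forall g, (u g \notin Dp) = (g \in pathsum @` A a)};
    pw_sum : u (pathsum a) = - a;
    pw_child : {in Pi, forall b, b != at0 -> p b = a -> u b = a + b};
    pw_ortho : forall x, {in A a, forall t, B x t = 0} -> u x = x }.

Lemma cartan_adj_long a b : a \in Pi -> b \in Pi -> B a b < 0 -> B b b = N ->
  cartan B a b = -1.
Proof.
move=> ha hb h bn; rewrite /cartan (adj_long ha hb h bn) bn.
by field; rewrite gt_eqF ?N_gt0.
Qed.

Lemma affine_refl0 a x t : affine_refl B a 0 (x, t) = (refl B a x, t).
Proof. by rewrite /affine_refl /= mul0r subr0. Qed.

Lemma path_word_exists a : a \in Pi -> B a a = N ->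
  exists w u, path_word a w u.
Proof.
move=> ha; elim/tree_ind: a / ha => [_|a ha ne pa IH an].
  exists (affine_refl B at0 0 \o (affine_refl B (- theta) 1 \o id)), (refl B at0).
  have h0 := root_neq0 at_root.
  split=> [|x t|x y|x|x y e|g hg||g hg||b hb bn pb|x hx].
  - do 2![apply: affine_weyl_refl; rewrite ?rootN ?at_root ?th_root //].
    exact: affine_weyl_id.
  - by rewrite /comp affine_reflN_theta affine_refl0.
  - exact: reflD.
  - exact: reflN.
  - by rewrite -(reflK B x h0) e reflK.
  - by apply: root_refl; rewrite ?at_root.
  - by rewrite /refl hfw // eqxx scale1r pathsum_at.
  - rewrite anc_at; apply/idP/imfsetP => /= [h|[t]].
      exists at0; rewrite ?inE // pathsum_at; apply/eqP/negPn/negP => gn.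
      by move/negP: h; apply; apply: refl_pos.
    rewrite inE => /eqP -> ->; rewrite pathsum_at reflxx //.
    exact: posN at_pos.
  - by rewrite pathsum_at reflxx.
  - have hadj := par_adj hb bn; rewrite pb formC in hadj.
    by rewrite /refl cartan_adj_long ?at_norm // scaleN1r opprK addrC.
  - by apply: refl_ortho; apply: hx; rewrite anc_at inE.
have [w [u [h1 h2 h3 h4 h5 h6 h7 h8 h9 h10 h11]]] := IH (par_long ha ne an).
have a0 := root_neq0 (simple_root ha).
have ua : u (pathsum a) = a.
  by rewrite pathsum_step // h3 h9 h10 // addrAC subrr add0r.
have ancE t : t \in A a -> t = a \/ t \in A (p a).
  by rewrite anc_step // !inE => /orP[/eqP ->|]; [left|right].
exists (affine_refl B a 0 \o w), (refl B a \o u).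
split=> [|x t|x y|x|x y e|g hg||g hg||b hb bn pb|x hx] /=.
- by apply: affine_weyl_refl; rewrite ?simple_root.
- by rewrite h2 affine_refl0.
- by rewrite h3 reflD.
- by rewrite h4 reflN.
- by apply: h5; rewrite -(reflK B (u x) a0) [refl B a (u x)]e reflK.
- by apply: root_refl; [apply: simple_root | apply: h6].
- rewrite h7 reflD reflN refl_ortho ?th_ortho // (pathsum_step ha ne).
  rewrite /refl /cartan form_pathsum_par //.
  have -> : 2 * B (p a) a / B a a = -1.
    by rewrite -/(cartan B (p a) a) cartan_adj_long // par_adj.
  by rewrite scaleN1r opprK [a + _]addrC.
(* Among roots, a simple reflection moves only [a] and [- a] across the sign. So the new inversion
   is the root with [u g = a], which is [pathsum a], and no old one is lost because [u g = - a]
   would make [g] negative. *)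
- have [ug|ug] := boolP (u g \in Dp).
    have [e|ne'] := eqVneq (u g) a.
      rewrite e reflxx // posN ?simple_pos //; apply/esym/imfsetP.
      exists a => /=; first exact: anc_self.
      by apply: h5; rewrite ua.
    rewrite refl_pos //; apply/esym/negbTE; apply/imfsetP => -[t /= /ancE[->|ht] e].
      by rewrite e ua eqxx in ne'.
    have : g \in pathsum @` A (p a) by apply/imfsetP; exists t.
    by rewrite -h8 // ug.
  have := ug; rewrite h8 // => /imfsetP[t /= ht e].
  have -> : g \in pathsum @` A a.
    by apply/imfsetP; exists t => //=; apply: anc_par.
  have nug : - u g \in Dp.
    by case: (pos_or_neg (h6 g (pos_root hg))) => // h; rewrite h in ug.
  rewrite -[u g]opprK reflN posN // refl_pos //.
  apply: contraTneq hg => e'; suff -> : g = - pathsum a.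
    by apply/posN/D1_pos/pathsum_D1.
  by apply: h5; rewrite h4 ua -e' opprK.
- by rewrite ua reflxx.
- have hadj := par_adj hb bn; rewrite pb formC in hadj.
  have -> : u b = b.
    apply: h11 => t ht; rewrite formC anc_ortho // pb; first exact: anc_par.
    by apply: contraNneq (par_notin ha ne) => e; rewrite -{1}e.
  by rewrite /refl cartan_adj_long // scaleN1r opprK addrC.
- rewrite h11 => [|t ht]; last by apply: hx; apply: anc_par.
  by apply: refl_ortho; apply: hx; apply: anc_self.
Qed.

Lemma root_pathsum_compl a : a \in Pi -> theta - pathsum a \in D1.
Proof. by move=> ha; apply/D1_compl/pathsum_D1. Qed.

Lemma rootlet_pathsum a : a \in Pi -> B a a = N ->
  has_rootlet B Delta Pi theta (ideal_ge Delta Pi (theta - pathsum a))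
    (theta - pathsum a).
Proof.
move=> ha an; have hD := root_pathsum_compl ha.
split; first exact: ideal_pathsum_abelian.
  apply/fset0Pn; exists theta; apply/ideal_pathsumP => //; by left.
have [w [u hw]] := path_word_exists ha an; exists w; last first.
  by rewrite (pw_E hw) reflN reflxx ?th_neq0 // opprK (pw_th hw) cfN cf_th subrr.
apply: (peterson_level (pw_weyl hw) (pw_E hw) (pw_N hw) _ _ (pw_inv hw)).
- by rewrite (pw_th hw) D1_pos.
- apply/fsubsetP => g /imfsetP[t /= ht ->].
  by apply: pathsum_D1; apply: anc_simple ht.
move=> g; rewrite ideal_pathsumP //; split=> -[->|]; try by left.
  move=> [t ht ->]; right; have tPi := anc_simple ha ht.
  split; first exact: root_pathsum_compl.
  by rewrite subKr; apply/imfsetP; exists t.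
by move=> [gD /imfsetP[t /= ht e]]; right; exists t => //; rewrite -e subKr.
Qed.

Lemma rootlet_theta :
  has_rootlet B Delta Pi theta (ideal_ge Delta Pi theta) theta.
Proof.
split; first exact: ideal_theta_abelian.
  by apply/fset0Pn; exists theta; rewrite ideal_theta inE.
exists (affine_refl B (- theta) 1 \o id); last first.
  by rewrite /comp affine_reflN_theta reflN reflxx ?th_neq0 // opprK cfN cf_th subrr.
apply: (@peterson_level _ id fset0) => //.
- apply: affine_weyl_refl; rewrite ?rootN ?th_root //.
  exact: affine_weyl_id.
- exact: affine_reflN_theta.
- exact: th_pos.
- by move=> g hg; rewrite hg inE.
move=> g; rewrite ideal_theta inE; split=> [/eqP ->|[->|[_]]] //.
by left.
Qed.

(** The point is to exclude an element [v] orthogonal to [theta]. Any root obtained by adding [v] to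
    an element of [D1] lies in [J] and is thus the complement of a path sum; a few such identities
    have incompatible pairings with [at0]. *)
Lemma ideal_level (J : {fset V}) : upper_ideal Delta Pi J ->
  {in J, forall g, g \in D1 -> exists2 t, t \in Pi & g = theta - pathsum t} ->
  {in J, forall g, g \in D1 \/ g = theta}.
Proof.
move=> [/fsubsetP sJ uJ] hJ v hv; have vp := sJ v hv.
have [->|ne] := eqVneq v theta; first by right.
left; rewrite mem_D1 vp; case: (pos_cf01 vp ne) => [e|->]; last by rewrite eqxx.
exfalso; have hN := N_gt0.
have vth : B v theta = 0 by rewrite form_th e !mul0r.
have up x : x \in D1 -> x + v \in Delta ->
    exists2 t, t \in Pi & x + v = theta - pathsum t.
  move=> hx hr.
  have hD : x + v \in D1 by apply: (root_D1 hr); rewrite cfD (D1_cf hx) e addr0.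
  apply: hJ => //; apply: (uJ v) => //; first exact: D1_pos.
  by apply/rleP => b hb; rewrite cfD addrK; apply: pos_cf (D1_pos hx) hb.
have [g gD gv] : exists2 g, g \in D1 & B g v < 0.
  (* The path sums span [V], as each simple root is [at0] or a difference of two of them, so they
     are not all orthogonal to [v]. *)
  have [t tPi tv] : exists2 t, t \in Pi & B (pathsum t) v != 0.
    apply: contrapT => hn.
    have hs t : t \in Pi -> B (pathsum t) v = 0.
      by move=> ht; apply/eqP/negPn/negP => h; apply: hn; exists t.
    have : B v v = 0.
      rewrite formcf big1_seq // => b /andP[_ hb].
      have [eb|bn] := eqVneq b at0; first by rewrite eb -pathsum_at hs ?mulr0.
      have := hs b hb; rewrite pathsum_step // formDl hs ?par_simple // addr0.
      by move=> ->; rewrite mulr0.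
    by apply/eqP; rewrite gt_eqF // root_norm // pos_root.
  have [h|h] := ltP (B (pathsum t) v) 0.
    by exists (pathsum t) => //; apply: pathsum_D1.
  exists (theta - pathsum t); first exact: root_pathsum_compl.
  by rewrite formDl formNl formC vth sub0r oppr_lt0 lt_neqAle eq_sym tv.
have gvr : g + v \in Delta.
  apply: (rootD (D1_root gD) (pos_root vp) gv); apply/eqP => h.
  by have := cfD at0 g v; rewrite h cf0 e (D1_cf gD); lra.
have [s sPi es] := up g gD gvr.
have gE : theta - g = pathsum s + v.
  by apply/eqP; rewrite subr_eq -addrA [v + g]addrC es addrC subrK.
(* The complement [theta - g] is again such a sum, so [v] equals [theta - pathsum r - pathsum s] and
   pairs negatively with [at0]. *)
have [r rPi er] : exists2 t, t \in Pi & pathsum s + v = theta - pathsum t.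
  by apply: up; [apply: pathsum_D1 | rewrite -gE; apply/D1_root/D1_compl].
have bs := pathsum_at_ge sPi; have br := pathsum_at_ge rPi.
have bth : B theta at0 = N / 2 by rewrite th_at at_norm.
have e1 : B v at0 = N / 2 - B (pathsum r) at0 - B (pathsum s) at0.
  have -> : v = theta - pathsum r - pathsum s by rewrite -er addrAC subrr add0r.
  by rewrite !formDl !formNl bth.
have vr := pos_root vp.
have vat : v != at0.
  apply/eqP => h; move: e; rewrite h cf_simple // eqxx => /eqP.
  by rewrite oner_eq0.
have vat' : v != - at0 by apply: contraTneq vp => ->; apply/posN/at_pos.
have lt0 : B v at0 < 0 by lra.
(* Hence [at0 + v] is a root and also the complement of a path sum. This puts the pairing of [v]
   with [at0] at or below [- N], whereas [long_cartan] allows nothing below [- (N / 2)]. *)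
have atv : at0 + v \in Delta.
  rewrite addrC; apply: rootD => //; first exact: at_root.
  by rewrite -[at0]opprK subr_eq0.
have [q qPi eq] := up at0 at_D1 atv.
have bq := pathsum_at_ge qPi.
have e2 : B v at0 = N / 2 - B (pathsum q) at0 - N.
  have -> : v = theta - pathsum q - at0 by rewrite -eq addrAC subrr add0r.
  by rewrite !formDl !formNl bth at_norm.
by case: (long_cartan vr at_root at_norm vat vat'); lra.
Qed.

(** By [ideal_count] the rootlet determines the number of elements in [D1], so the inclusion is an
    equality there; [ideal_level] leaves [J] no elements elsewhere except [theta]. *)
Lemma rootlet_max (I J : {fset V}) a : has_rootlet B Delta Pi theta I a ->
  has_rootlet B Delta Pi theta J a -> a \in Dp -> theta \in I -> I `<=` J ->
  {in I, forall g, g \in D1 -> exists2 t, t \in Pi & g = theta - pathsum t} ->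
  J = I.
Proof.
move=> hI hJ ha thI sIJ hD.
have eD : I `&` D1 = J `&` D1.
  apply/eqP; rewrite -(fsubset_leqif_cards (fsetSI D1 sIJ)).
  by rewrite -(eqr_nat R) (ideal_count hI) // (ideal_count hJ).
have mD g : g \in D1 -> (g \in I) = (g \in J).
  move=> hg; have := congr1 (fun S : {fset V} => g \in S) eD.
  by rewrite !in_fsetI hg !andbT.
have [[uJ _] _ _] := hJ.
have lev : {in J, forall g, g \in D1 \/ g = theta}.
  by apply: ideal_level => // g hg gD; apply: hD => //; rewrite mD.
apply/eqP; rewrite eqEfsubset sIJ andbT; apply/fsubsetP => g hg.
by case: (lev g hg) => [gD|->//]; rewrite mD.
Qed.

Lemma amazing_theta : amazing B Delta Pi theta theta.
Proof.
split; first exact: th_pos.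
  by rewrite longP th_root eqxx.
split; first exact: rootlet_theta.
move=> J hJ sJ; apply: rootlet_max rootlet_theta hJ th_pos _ sJ _.
  by rewrite ideal_theta inE.
move=> g; rewrite ideal_theta inE => /eqP -> /D1_neq_th.
by rewrite eqxx.
Qed.

Lemma amazing_pathsum a : a \in Pi -> B a a = N ->
  amazing B Delta Pi theta (theta - pathsum a).
Proof.
move=> ha an; have hD := root_pathsum_compl ha; split; first exact: D1_pos.
  by rewrite longP D1_root // D1_compl_norm ?pathsum_D1 ?pathsum_long ?eqxx.
have hr := rootlet_pathsum ha an; split=> // J hJ sJ.
apply: rootlet_max hr hJ (D1_pos hD) _ sJ _.
  by apply/ideal_pathsumP => //; left.
move=> g /(ideal_pathsumP _ ha)[->|[t ht ->]] gD.
  by have := D1_neq_th gD; rewrite eqxx.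
by exists t => //; apply: anc_simple ht.
Qed.

(** * Amazing roots come from path sums *)

(** All nodes on the path are long, so [t] contributes [N] and each of its at most two neighbours on
    the path contributes [- (N / 2)]. *)
Lemma pathsum_pair_ge0 a t : a \in Pi -> B a a = N -> t \in A a ->
  0 <= B (pathsum a) t.
Proof.
move=> ha; elim/tree_ind: a / ha t => [|a ha ne pa IH] t an.
  by rewrite anc_at pathsum_at inE => /eqP ->; apply: norm_ge0.
have pn := par_long ha ne an; have hN := N_gt0.
have e1 := adj_long pa ha (par_adj ha ne) an.
rewrite (pathsum_step ha ne) anc_step // formDl !inE => /orP[/eqP ->|ht].
  by rewrite form_pathsum_par // an e1; lra.
have [->|tp] := eqVneq t (p a); last first.
  by rewrite (formC B a) anc_ortho // add0r IH.
rewrite (formC B a) e1; have [->|pne] := eqVneq (p a) at0.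
  by rewrite pathsum_at at_norm; lra.
have ppa := par_simple pa pne.
rewrite (pathsum_step pa pne) formDl form_pathsum_par // pn.
by rewrite (adj_long ppa pa (par_adj pa pne) pn); lra.
Qed.

Definition interval y : {fset V} := [fset g in D1 | rle Pi g y].

Lemma mem_interval y g : (g \in interval y) = (g \in D1) && rle Pi g y.
Proof. by rewrite !inE. Qed.

(* [hsum y / N] is the height of the coroot of [y]; going down from [y] to
   [at0] by simple reflections produces that many elements of the interval,
   and one more for each short simple root used. *)
Lemma interval_card y : y \in D1 -> B y y = N ->
  hsum y / N <= (#|` interval y|)%:R /\
  (hsum y / N = (#|` interval y|)%:R ->
    exists b, [/\ b \in Pi, B b b = N & y = pathsum b]).
Proof.
move=> hy; have hN := N_gt0; have yp := D1_pos hy.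
elim/pos_ind: y / yp hy => y yp IH hy yn.
have yy : y \in interval y by rewrite mem_interval hy rle_refl.
have [e|ne] := eqVneq y at0.
  rewrite {1 3}e hsum_simple // at_norm divff ?gt_eqF //; split=> [|_].
    by rewrite ler1n cardfs_gt0; apply/fset0Pn; exists y.
  by exists at0; rewrite hat0 at_norm pathsum_at.
have yr := D1_root hy.
have neg b : b \in Pi -> y != - b.
  by move=> hb; apply: contraTneq yp => ->; apply/posN/simple_pos.
(* Otherwise the norm of [y], whose coordinate at [at0] is 1, would be at most its pairing with
   [at0], hence at most [N / 2]. *)
have [b [hb bn yb]] : exists b, [/\ b \in Pi, b != at0 & 0 < B y b].
  apply: contrapT => hn; have : B y y <= B at0 y.
    rewrite formcf (bigD1_seq at0) ?fset_uniq //= D1_cf // mul1r gerDl.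
    rewrite big_seq_cond sumr_le0 // => b /andP[hb bn].
    rewrite mulr_ge0_le0 ?pos_cf_ge0 // formC leNgt; apply/negP => h.
    by apply: hn; exists b.
  rewrite yn formC.
  by case: (long_cartan yr at_root at_norm ne (neg _ hat0)) => ->; lra.
have br := simple_root hb; have b0 := root_norm br.
have yneb : y != b.
  apply/eqP => e; have := D1_cf hy; rewrite e (cf_simple hb hat0) eq_sym.
  by rewrite (negPf bn) => /eqP; rewrite eq_sym oner_eq0.
have bny : b != - y by rewrite -[b]opprK (inj_eq oppr_inj) eq_sym neg.
have byE : B y b = N / 2.
  rewrite eq_sym in yneb; move: yb; rewrite formC.
  by case: (long_cartan br yr yn yneb bny) => ->; lra.
(* The descent: [hsum y / N] drops by exactly 1 whatever the length of [b], while the interval loses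
   at least [y]. *)
pose z := refl B b y.
have zE : z = y - (N / B b b) *: b.
  by rewrite /z /refl /cartan byE; congr (_ - _ *: _); field; rewrite gt_eqF.
have zp : z \in Dp by apply: refl_pos.
have zle : rle Pi z y by apply: refl_le_cf.
have zD : z \in D1.
  apply: root_D1; first exact: pos_root.
  by rewrite zE cfB cfZ (cf_simple hb hat0) eq_sym (negPf bn) mulr0 subr0 D1_cf.
have zn : B z z = N by rewrite form_refl // root_neq0.
have zy : z != y by apply: refl_neq; rewrite // gt_eqF.
have hz : hsum z / N = hsum y / N - 1.
  rewrite zE hsumB hsumZ (hsum_simple hb) divfK ?gt_eqF // mulrBl divff ?gt_eqF //.
have [le eq] := IH z zp zle zy zD zn.
have yz : y \notin interval z.
  rewrite mem_interval hy /=; apply: contraNN zy => h.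
  by apply/eqP/rle_anti.
have sz : y |` interval z `<=` interval y.
  apply/fsubsetP => g; rewrite in_fset1U => /orP[/eqP -> //|].
  by rewrite !mem_interval => /andP[-> h]; apply: rle_trans h zle.
have c1 : (#|` y |` interval z| = #|` interval z|.+1)%N.
  by rewrite cardfsU1 yz.
have c2 : (#|` interval z|.+1 <= #|` interval y|)%N.
  by rewrite -c1; apply: fsubset_leq_card.
have c2R : (#|` interval z|)%:R + 1 <= (#|` interval y|)%:R :> R.
  by rewrite natr1 ler_nat.
split; first by lra.
move=> eqy.
(* Equality for [y] passes to [z], and [y] is then the only element of its interval missing from
   that of [z]. *)
have eqc : #|` interval y| = #|` interval z|.+1.
  by apply/eqP; rewrite eqn_leq c2 andbT -(ler_nat R) -natr1; lra.
have iE : y |` interval z = interval y.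
  by apply/eqP; rewrite -(fsubset_leqif_cards sz) c1 eqc.
(* For short [b] the ratio [N / B b b] exceeds 1, and [y - b] would be a second new element,
   strictly between [z] and [y]. *)
have bN : B b b = N.
  apply: contrapT => nl; have bl : B b b < N.
    by rewrite lt_neqAle th_long // andbT; apply/eqP.
  have hr : y - b \in Dp by apply: pos_subr.
  have : y - b \in interval y.
    rewrite mem_interval mem_D1 hr cfB (cf_simple hb hat0) [at0 == b]eq_sym (negPf bn).
    rewrite subr0 D1_cf // eqxx /=; apply/rleP => c hc; exists (c == b : nat).
    by rewrite cfB (cf_simple hb hc); ring.
  rewrite -iE in_fset1U -subr_eq0 addrAC subrr sub0r oppr_eq0.
  rewrite (negPf (root_neq0 br)) mem_interval => /andP[_ h]; have := rle_cf h hb.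
  rewrite zE !cfB cfZ (cf_simple hb hb) eqxx mulr1n mulr1.
  have : 1 < N / B b b by rewrite ltr_pdivlMr // mul1r.
  by lra.
have ez : hsum z / N = (#|` interval z|)%:R.
  by rewrite hz eqy eqc -natr1 addrK.
have [a [ha an za]] := eq ez.
have yE : y = b + pathsum a.
  by rewrite -za zE bN divff ?gt_eqF // scale1r addrC subrK.
have zb : B (pathsum a) b < 0.
  have : B y b = B b b + B (pathsum a) b by rewrite yE formDl.
  by rewrite byE bN; lra.
(* Now [b] must be a child of some node [t] on the path to [a]. Then [pathsum b] lies below [y] but
   not below [z], so it is the new element [y]. *)
have [t ht tb] : exists2 t, t \in A a & B t b < 0.
  apply: contrapT => hn; move: zb; rewrite /pathsum /vsum form_suml.
  rewrite big_seq ltNge => /negP; apply; apply: sumr_ge0 => t ht.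
  by rewrite leNgt; apply/negP => h; apply: hn; exists t.
have tPi := anc_simple ha ht.
have bA : b \notin A a.
  apply/negP => h; have := pathsum_pair_ge0 ha an h.
  by rewrite leNgt zb.
case: (adj_par tPi hb tb) => -[tn e].
  have /negP[] := bA; apply: (fsubsetP (anc_trans ha ht)).
  by rewrite e; apply: par_anc.
exists b; split=> //; have : pathsum b \in interval y.
  rewrite mem_interval pathsum_D1 //= (pathsum_step hb tn) -e yE.
  have /rleP h := rle_pathsum ha ht; apply/rleP => c hc.
  by have [n hn] := h c hc; exists n; rewrite !cfD -hn; ring.
rewrite -iE in_fset1U => /orP[/eqP->//|].
rewrite mem_interval => /andP[_ h]; have := rle_cf h hb.
by rewrite za !cf_pathsum // anc_self // (negPf bA) ler10.
Qed.

(** Taking complements in [theta] carries the part in [D1] of the ideal above [x] to the interval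
    below [theta - x]. So [ideal_count] puts [theta - x] in the equality case of [interval_card]. *)
Lemma amazing_inv x : amazing B Delta Pi theta x -> B x theta != 0 ->
  x = theta \/ exists b, [/\ b \in Pi, B b b = N & x = theta - pathsum b].
Proof.
move=> [xp xl [hr _]] xth; have [->|ne] := eqVneq x theta; [by left|right].
have xD : x \in D1.
  rewrite mem_D1 xp; case: (pos_cf01 xp ne) => e; last by rewrite e eqxx.
  by move: xth; rewrite form_th e !mul0r eqxx.
have xn : B x x = N by move: xl; rewrite longP => /andP[_ /eqP].
have cnt := ideal_count hr xp.
have [_ h] := interval_card (D1_compl xD) (etrans (D1_compl_norm xD) xn).
have [|b [hb bn e]] := h.
  rewrite -cnt; congr (_%:R).
  have -> : interval (theta - x) =
      [fset theta - g | g in ideal_ge Delta Pi x `&` D1].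
    apply/fsetP => g; rewrite mem_interval; apply/andP/imfsetP => /=.
      move=> [gD le]; exists (theta - g); last by rewrite subKr.
      rewrite in_fsetI mem_ideal_ge D1_compl // D1_pos ?D1_compl //= andbT.
      by rewrite -[x](subKr theta) rle_subC subKr.
    move=> [g']; rewrite in_fsetI mem_ideal_ge => /andP[/andP[_ le] gD] ->.
    by rewrite D1_compl // rle_subC subKr.
  have inj : injective (fun g => theta - g) by move=> u v /addrI/oppr_inj.
  by rewrite [RHS](card_imfset _ _ inj).
by exists b; split=> //; rewrite -e subKr.
Qed.

Lemma mem_amazingH x : x \in amazingH B Delta Pi theta <->
  x = theta \/ exists b, [/\ b \in Pi, long B Delta b & x = theta - pathsum b].
Proof.
have longE b : b \in Pi -> long B Delta b = (B b b == N).
  by move=> hb; rewrite longP simple_root.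
split.
  rewrite !inE /= => /and3P[_ /asboolP ha hx].
  case: (amazing_inv ha hx) => [->|[b [hb bn ->]]]; [by left|right].
  by exists b; rewrite longE // bn eqxx.
have H g : amazing B Delta Pi theta g -> B g theta != 0 ->
    g \in amazingH B Delta Pi theta.
  move=> hg h; have [gp _ _] := hg.
  by move: gp; rewrite !inE /= h andbT => ->; apply/asboolP.
case=> [->|[b [hb]]]; first by apply: H amazing_theta _; rewrite gt_eqF ?N_gt0.
rewrite longE // => /eqP bn ->; apply: H; first exact: amazing_pathsum.
by rewrite D1_th ?root_pathsum_compl // mulf_neq0 ?gt_eqF ?N_gt0 ?invr_gt0 ?ltr0n.
Qed.

(** * Hasse diagrams *)

Lemma rle_pathsumE a b : a \in Pi -> b \in Pi ->
  rle Pi (theta - pathsum a) (theta - pathsum b) = (b \in A a).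
Proof.
move=> ha hb; rewrite rle_subC subKr; apply/idP/idP => [h|]; last exact: rle_pathsum.
have := rle_cf h hb; rewrite !cf_pathsum // anc_self //.
by case: (b \in A a); rewrite // ler10.
Qed.

Lemma pathsum_inj a b : a \in Pi -> b \in Pi -> pathsum a = pathsum b -> a = b.
Proof.
move=> ha hb e; apply/esym/anc_anti => //.
  by rewrite -rle_pathsumE // e rle_refl.
by rewrite -rle_pathsumE // e rle_refl.
Qed.

Lemma pathsum_compl_neq a : a \in Pi -> theta - pathsum a != theta.
Proof. by move/root_pathsum_compl/D1_neq_th. Qed.

(** This is the vertex that covers [theta - pathsum a], as [coversP] shows; by [upperB] the edge
    between them has label [a]. *)
Definition upper a : V := if a == at0 then theta else theta - pathsum (p a).

Lemma upperB a : a \in Pi -> upper a - (theta - pathsum a) = a.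
Proof.
move=> ha; rewrite /upper; case: eqP => [->|/eqP ne].
  by rewrite subKr pathsum_at.
by apply/eqP; rewrite subr_eq (pathsum_step ha ne) opprD addrCA addNKr.
Qed.

Section Diagram.

Variable P : {fset V}.
Hypothesis PPi : P `<=` Pi.
Hypothesis Pat : at0 \in P.
Hypothesis Ppar : {in P, forall a, a != at0 -> p a \in P}.

(** With [P] the set of long simple roots this is the set of amazing roots not orthogonal to
    [theta]; with [P = Pi] it is the enlarged poset of (iii). *)
Definition tree_roots : {fset V} := theta |` [fset theta - pathsum a | a in P].

Lemma tree_rootsP x :
  reflect (x = theta \/ exists2 a, a \in P & x = theta - pathsum a)
    (x \in tree_roots).
Proof.
rewrite in_fset1U.
apply: (iffP orP) => [[/eqP|/imfsetP[a /= ha ->]]|[->|[a ha ->]]].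
- by left.
- by right; exists a.
- by left.
- by right; apply/imfsetP; exists a.
Qed.

Lemma P_simple a : a \in P -> a \in Pi.
Proof. by move/(fsubsetP PPi). Qed.

Lemma upper_in a : a \in P -> upper a \in tree_roots.
Proof.
move=> ha; apply/tree_rootsP; rewrite /upper; case: eqP => [_|/eqP ne].
  by left.
by right; exists (p a); first exact: Ppar.
Qed.

Lemma rle_upper a : a \in Pi -> rle Pi (theta - pathsum a) (upper a).
Proof.
move=> ha; rewrite /upper; case: eqP => [_|/eqP ne].
  by apply/th_max/D1_pos/root_pathsum_compl.
by rewrite rle_pathsumE ?par_simple // par_anc.
Qed.

Lemma upper_neq a : a \in Pi -> theta - pathsum a != upper a.
Proof.
move=> ha; rewrite eq_sym -subr_eq0 upperB //.
by apply/root_neq0/simple_root.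
Qed.

Lemma upper_least a x : a \in P -> x \in tree_roots ->
  rle Pi (theta - pathsum a) x -> theta - pathsum a != x ->
  rle Pi (upper a) x.
Proof.
move=> /P_simple ha /tree_rootsP[-> _ _|[b /P_simple hb ->]].
  rewrite /upper; case: eqP => [_|/eqP ne]; first exact: rle_refl.
  by apply/th_max/D1_pos/root_pathsum_compl/par_simple.
rewrite rle_pathsumE // /upper; have [->|ne] := eqVneq a at0.
  by rewrite anc_at inE => /eqP ->; rewrite eqxx.
rewrite anc_step // !inE => /orP[/eqP ->|h _]; first by rewrite eqxx.
by rewrite rle_pathsumE // par_simple.
Qed.

(** By [upper_least] the vertices strictly above [theta - pathsum a] have a least element, so there
    is exactly one cover. *)
Lemma coversP x y : reflect (exists a, [/\ a \in P, x = upper a &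
    y = theta - pathsum a]) (covers Pi tree_roots x y).
Proof.
apply: (iffP idP) => [/and5P[hy hx ne le /allP btw]|[a [ha -> ->]]].
  case/tree_rootsP: (hy) => [e|[a ha e]].
    move: ne; rewrite e; suff -> : x = theta by rewrite eqxx.
    apply: rle_anti; last by rewrite -e.
    case/tree_rootsP: hx => [->|[b /P_simple hb ->]]; first exact: rle_refl.
    by apply/th_max/D1_pos/root_pathsum_compl.
  have ha' := P_simple ha; exists a; split=> //.
  rewrite e in le ne btw.
  have := btw _ (upper_in ha); rewrite rle_upper // upper_least //=.
  by rewrite eq_sym (negPf (upper_neq ha')) => /eqP.
have ha' := P_simple ha.
rewrite /covers upper_in // upper_neq // rle_upper //=; apply/andP; split.
  by apply/tree_rootsP; right; exists a.
apply/allP => z hz; apply/implyP => /andP[h1 h2].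
have [//|ne] := eqVneq z (theta - pathsum a).
rewrite eq_sym in ne; apply/eqP; apply: rle_anti => //.
exact: upper_least.
Qed.

Lemma covers_pathsum a b : a \in P -> b \in P ->
  covers Pi tree_roots (theta - pathsum a) (theta - pathsum b) =
  (b != at0) && (a == p b).
Proof.
move=> ha hb; have ha' := P_simple ha; have hb' := P_simple hb.
apply/coversP/andP => [[c [hc e /addrI/oppr_inj]]|[ne /eqP ->]].
  move/(pathsum_inj hb' (P_simple hc)) => ebc.
  move: e; rewrite -ebc /upper; case: eqP => [_ /eqP|/eqP ne].
    by rewrite (negPf (pathsum_compl_neq ha')).
  by move=> /addrI/oppr_inj/pathsum_inj ->; rewrite ?eqxx ?par_simple.
by exists b; rewrite /upper (negPf ne).
Qed.

Lemma covers_theta b : b \in P ->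
  covers Pi tree_roots theta (theta - pathsum b) = (b == at0).
Proof.
move=> hb; have hb' := P_simple hb.
apply/coversP/eqP => [[c [hc e /addrI/oppr_inj]]|->].
  move/(pathsum_inj hb' (P_simple hc)) => ->; apply/eqP.
  move: e; rewrite /upper; case: (c == at0) / eqP => // /eqP ne.
  move/esym/eqP; rewrite (negPf (pathsum_compl_neq _)) // par_simple //.
  exact: P_simple.
by exists at0; rewrite /upper eqxx.
Qed.

Lemma theta_covers x : covers Pi tree_roots x theta = false.
Proof.
apply/coversP => -[a [/P_simple/pathsum_compl_neq/eqP ne _ e]].
by apply: ne.
Qed.

Definition above x : {fset V} := [fset y in tree_roots | rle Pi x y].

Lemma mem_above x y : (y \in above x) = (y \in tree_roots) && rle Pi x y.
Proof. by rewrite !inE. Qed.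

Lemma covers_above x y : covers Pi tree_roots x y -> above x `<` above y.
Proof.
move=> /and5P[hy hx ne le _]; rewrite fproperE; apply/andP; split.
  apply/fsubsetP => z; rewrite !mem_above => /andP[-> h].
  exact: rle_trans le h.
apply/fsubsetPn; exists y; rewrite !mem_above hy ?rle_refl //=.
by apply: contra ne => h; apply/eqP/rle_anti.
Qed.

(** The rank of a vertex is the number of vertices above it. Then [theta] is the root, and the only
    neighbour of smaller or equal rank is the unique cover. *)
Lemma tree_roots_tree : is_tree (@hasse R V Pi tree_roots).
Proof.
have hr : theta \in tree_roots by apply/tree_rootsP; left.
have lt x y : covers Pi tree_roots x y -> (#|` above x| < #|` above y|)%N.
  by move/covers_above/fproper_ltn_card.
apply: (@ranked_tree _ (@hasse R V Pi tree_roots) [` hr]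
  (fun x : tree_roots => #|` above (val x)|)).
- by move=> x y; rewrite /hasse /= /hasse_adj orbC.
- move=> x ne; case/tree_rootsP: (valP x) => [e|[a ha e]].
    by move/eqP: ne; case; apply: val_inj.
  have c : covers Pi tree_roots (upper a) (val x) by apply/coversP; exists a.
  exists [` upper_in ha]; last exact: lt.
  by rewrite /hasse /hasse_adj /= c orbT.
move=> x y z; rewrite /hasse /hasse_adj /=.
case/orP => [/lt h|/coversP[a [ha ey ex]]].
  by move=> _ /leq_ltn_trans/(_ h); rewrite ltnn.
case/orP => [/lt h|/coversP[b [hb ez ex']]].
  by move=> _ /leq_ltn_trans/(_ h); rewrite ltnn.
move=> _ _; apply: val_inj; rewrite /= ey ez; congr upper.
apply: pathsum_inj; rewrite ?P_simple //.
by apply/oppr_inj/(@addrI _ theta); rewrite -ex.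
Qed.

Lemma hasse_edgesP e : reflect (exists2 a, a \in P &
    e = (upper a, theta - pathsum a)) (e \in hasse_edges Pi tree_roots).
Proof.
rewrite !inE /= -!in_fset1U -/tree_roots; case: e => x y /=.
apply: (iffP andP) => [[_ /coversP[a [ha -> ->]]]|[a ha [-> ->]]].
  by exists a.
have c : covers Pi tree_roots (upper a) (theta - pathsum a).
  by apply/coversP; exists a.
by rewrite c; case/and5P: c => -> ->.
Qed.

Lemma tree_roots_edges : edges_biject Pi tree_roots P.
Proof.
split.
  move=> e1 e2 /hasse_edgesP[a /P_simple ha ->] /hasse_edgesP[b /P_simple hb ->].
  by rewrite /edge_label /= !upperB // => ->.
apply/fsetP => x; apply/imfsetP/idP => /=.
  move=> [e /hasse_edgesP[a ha ->] ->].
  by rewrite /edge_label /= upperB ?P_simple.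
move=> hx; exists (upper x, theta - pathsum x); first by apply/hasse_edgesP; exists x.
by rewrite /edge_label /= upperB ?P_simple.
Qed.

Lemma card_tree_roots : #|` tree_roots| = (#|` P| + 1)%N.
Proof.
rewrite /tree_roots cardfsU1 card_in_imfset /=; last first.
  move=> a b ha hb /addrI/oppr_inj.
  by apply: pathsum_inj; apply: P_simple.
suff -> : theta \notin [fset theta - pathsum a | a in P] by rewrite addnC.
apply/imfsetP => -[a /= /P_simple/pathsum_compl_neq/eqP ne e].
by apply: ne.
Qed.

(** A simple root goes to the lower end of the edge that it labels. *)
Definition node_map (x : ext_node Pi) : V :=
  if x is Some a then theta - pathsum (val a) else theta.

Definition node_in (x : ext_node Pi) : bool :=
  if x is Some a then val a \in P else true.

Lemma node_map_biject (D : {set ext_node Pi}) :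
  (forall x : ext_node Pi, (x \in D) = node_in x) ->
  nodes_biject D tree_roots node_map.
Proof.
move=> hD; split.
  move=> [a|] [b|] _ _ //=.
  - move=> /addrI/oppr_inj/(pathsum_inj (valP a) (valP b)) e.
    by congr Some; apply: val_inj.
  - by move/eqP; rewrite (negPf (pathsum_compl_neq (valP a))).
  - by move/esym/eqP; rewrite (negPf (pathsum_compl_neq (valP b))).
apply/fsetP => x; apply/imfsetP/tree_rootsP => /=.
  move=> [[a|] ]; rewrite hD /= => ha ->; last by left.
  by right; exists (val a).
case=> [->|[a ha ->]]; first by exists None; rewrite ?hD.
by exists (Some [` P_simple ha]); rewrite ?hD.
Qed.

(** Both relations are the parent relation of the tree, extended by an edge from the extra node to
    [at0], the only simple root not orthogonal to [theta]. *)
Lemma node_map_adj (x y : ext_node Pi) : node_in x -> node_in y -> x != y ->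
  hasse_adj Pi tree_roots (node_map x) (node_map y) =
  (B (node_root theta x) (node_root theta y) != 0).
Proof.
rewrite /hasse_adj.
have thb b : b \in Pi -> (B (- theta) b != 0) = (b == at0).
  move=> hb; rewrite formNl oppr_eq0; have [->|ne] := eqVneq b at0.
    by rewrite th_at at_norm gt_eqF // divr_gt0 ?N_gt0.
  by rewrite th_ortho ?eqxx.
case: x y => [a|] [b|] //= ha hb ne.
- rewrite !covers_pathsum //.
  have ab : val a != val b by apply: contraNneq ne => /val_inj ->.
  apply/orP/idP => [[/andP[n /eqP ->]|/andP[n /eqP ->]]|h].
  + by rewrite lt_eqF // par_adj // valP.
  + by rewrite formC lt_eqF // par_adj // valP.
  + case: (adj_par (valP a) (valP b) (simple_adj (valP a) (valP b) ab h)).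
      by move=> [n /eqP e]; right; rewrite n.
    by move=> [n /eqP e]; left; rewrite n.
- by rewrite theta_covers covers_theta // formC thb // valP.
- by rewrite theta_covers covers_theta ?orbF ?thb // valP.
Qed.

End Diagram.

(** * Lines and root lengths in the extended Dynkin diagram *)

Lemma theta_not_simple b : b \in Pi -> b != theta.
Proof.
move=> hb; apply/eqP => e; have := cf_th; rewrite -e cf_simple //.
by case: (at0 == b); rewrite ?mulr0n ?mulr1n; lra.
Qed.

Lemma node_root_neq (x y : ext_node Pi) : x != y ->
  node_root theta x != node_root theta y /\
  node_root theta x != - node_root theta y.
Proof.
have neg a : a \in Pi -> - a != theta.
  by move=> ha; apply: contraTneq th_pos => <-; apply/posN/simple_pos.
case: x y => [a|] [b|] //= xy.
- split; first by apply: contraNneq xy => /val_inj ->.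
  apply: contraTneq (simple_pos (valP a)) => /= ->.
  exact/posN/simple_pos/valP.
- by rewrite opprK -eqr_oppLR neg ?theta_not_simple ?(valP a).
- by rewrite !eqr_oppLR opprK ![theta == _]eq_sym neg ?theta_not_simple.
Qed.

(** Distinct nodes are neither equal nor opposite as roots, so two long ones pair to 0 or to half
    the norm up to sign; the product of their Cartan integers is then 0 or 1. *)
Lemma lines_long (x y : ext_node Pi) : x != y ->
  long B Delta (node_root theta x) -> long B Delta (node_root theta y) ->
  lines B theta x y =
  (B (node_root theta x) (node_root theta y) != 0)%:R.
Proof.
rewrite !longP => /node_root_neq[]; rewrite /lines /cartan.
set r := node_root theta x; set s := node_root theta y.
move=> rs rs' /andP[hr /eqP rn] /andP[hs /eqP sn].
rewrite (formC B s r) rn sn; have hN := N_gt0.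
case: (long_cartan hr hs sn rs rs') => ->.
- by rewrite eqxx !(mulr0, mul0r).
- by rewrite gt_eqF ?divr_gt0 //=; field; rewrite gt_eqF.
- by rewrite oppr_eq0 gt_eqF ?divr_gt0 //=; field; rewrite gt_eqF.
Qed.

(** Complements in [theta] preserve the norm on [D1], and a path sum is no longer than the last node
    of its path. *)
Lemma short_pathsum a : a \in Pi -> ~~ long B Delta a ->
  short B Delta (theta - pathsum a) /\
  commutative_root Delta Pi (theta - pathsum a).
Proof.
move=> ha; have hD := root_pathsum_compl ha; rewrite longP simple_root //= => an.
split; last by split; [apply: D1_pos | apply: ideal_pathsum_abelian].
rewrite /short longP D1_root //= lt_eqF // D1_compl_norm ?pathsum_D1 //.
apply: le_lt_trans (pathsum_norm ha (anc_self ha)) _.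
by rewrite lt_neqAle an th_long ?simple_root.
Qed.

End RootSystem.

Lemma cartan_mul_eq0 (R : realFieldType) (V : vectType R)
    (B : {dot V for idfun}) (x y : V) : x != 0 -> y != 0 ->
  (cartan B x y * cartan B y x == 0) = (B x y == 0).
Proof.
move=> hx hy; rewrite /cartan (formC B y x) !mulf_eq0 !invr_eq0 pnatr_eq0 /=.
by rewrite (gt_eqF (norm_gt0 B hx)) (gt_eqF (norm_gt0 B hy)) !orbF orbb.
Qed.

Theorem theorem3p3 (R : realFieldType) (V : vectType R) (B : {dot V for idfun})
    (Delta Pi : {fset V}) (theta : V)
    (hDelta : root_system B Delta) (hirr : irreducible B Delta)
    (hPi : simple_roots Delta Pi) (htheta : highest_root Delta Pi theta)
    (hfund : fundamental_weight B Pi theta) :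
  let Pil := [fset a in Pi | long B Delta a] in
  let AH := amazingH B Delta Pi theta in
  let D := long_nodes B Delta Pi theta in
  (* (i) *)
  #|` AH| = (#|` Pil| + 1)%N /\
  (* (ii) and (iv) *)
  AH `<=` posroots Delta Pi /\
  is_tree (@hasse R V Pi AH) /\
  edges_biject Pi AH Pil /\
  exists phi : ext_node Pi -> V,
    [/\ diagram_iso B theta D AH phi,
        phi None = theta
      & (* (iii) and (iv) *)
        (exists a, short B Delta a) ->
        exists S : {fset V},
          [/\ {in S, forall a, short B Delta a /\ commutative_root Delta Pi a},
              is_tree (@hasse R V Pi (AH `|` S)),
              edges_biject Pi (AH `|` S) Pi
            & exists psi : ext_node Pi -> V,
                [/\ graph_iso B theta [set: ext_node Pi] (AH `|` S) psi,
                    {in D, psi =1 phi}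
                  & psi None = theta]]].
Proof.
move=> Pil AH D; have [at0 hat0 hfw] := hfund.
have [p [A hT]] := rooted_tree_exists hDelta hPi htheta hat0 hfw.
have longE := longP hDelta hPi htheta hat0 hfw.
have PilE a : (a \in Pil) = (a \in Pi) && (B a a == B theta theta).
  rewrite !inE /= longE; case ha: (a \in Pi) => //=.
  by rewrite (simple_root hPi ha).
have sPil : Pil `<=` Pi.
  by apply/fsubsetP => a; rewrite PilE => /andP[].
have Pilat : at0 \in Pil.
  by rewrite PilE hat0 (at_norm hDelta hPi htheta hat0 hfw) eqxx.
(* The long simple roots form a subtree containing [at0], because the parent of a long node is
   long. *)
have Pilpar : {in Pil, forall a, a != at0 -> p a \in Pil}.
  move=> a; rewrite !PilE => /andP[ha /eqP an] ne.
  rewrite (par_simple hT ha ne).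
  by rewrite (par_long hDelta hPi htheta hat0 hfw hT ha ne an) eqxx.
have Pipar : {in Pi, forall a, a != at0 -> p a \in Pi} := par_simple hT.
have AHE : AH = tree_roots theta A Pil.
  apply/fsetP => x; apply/idP/tree_rootsP.
    move/(mem_amazingH hDelta hPi htheta hat0 hfw hT) => [->|[b [hb bl ->]]].
      by left.
    by right; exists b; rewrite ?inE /= ?hb.
  move=> h; apply/(mem_amazingH hDelta hPi htheta hat0 hfw hT).
  case: h => [->|[b hb ->]]; [by left|right; exists b].
  by move: hb; rewrite !inE /= => /andP[].
have DE (x : ext_node Pi) : (x \in D) = node_in Pil x.
  rewrite !inE longE; case: x => [a|] /=; last first.
    by rewrite formNl formNr opprK (rootN hDelta) ?eqxx ?(th_root htheta).
  by rewrite PilE (simple_root hPi (valP a)) (valP a).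
have node0 (x : ext_node Pi) : node_root theta x != 0.
  case: x => [a|] /=.
    exact/(root_neq0 hDelta)/(simple_root hPi)/valP.
  by rewrite oppr_eq0; apply/(root_neq0 hDelta)/(th_root htheta).
split.
  by rewrite AHE (card_tree_roots hDelta hPi htheta hat0 hfw hT).
split.
  by apply/fsubsetP => x; rewrite !inE /= => /andP[].
split.
  by rewrite AHE; apply: (tree_roots_tree hDelta hPi htheta hat0 hfw hT).
split.
  by rewrite AHE; apply: (tree_roots_edges hDelta hPi htheta hat0 hfw hT).
exists (node_map theta A); split=> //.
  split; first by rewrite AHE; apply: (node_map_biject hDelta hPi htheta hat0 hfw hT).
  move=> x y; rewrite !DE => hx hy xy.
  rewrite AHE (node_map_adj hDelta hPi htheta hat0 hfw hT) //.
  apply: (lines_long hDelta hPi htheta hat0 hfw) => //.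
    by move: hx; rewrite -DE inE.
  by move: hy; rewrite -DE inE.
have nodeT (x : ext_node Pi) : node_in Pi x.
  by case: x => [a|] //=; apply: valP.
move=> _.
(* The short simple roots supply the missing vertices, so that the union is the tree over all of
   [Pi]. *)
exists [fset theta - pathsum A a | a in [fset a in Pi | ~~ long B Delta a]].
set S := imfset _ _ _.
have SE : AH `|` S = tree_roots theta A Pi.
  apply/fsetP => x; rewrite in_fsetU AHE.
  apply/orP/tree_rootsP => [[/tree_rootsP[->|[a ha ->]]|]|[->|[a ha ->]]].
  - by left.
  - by right; exists a => //; apply: (fsubsetP sPil).
  - by case/imfsetP => a /=; rewrite !inE /= => /andP[ha _] ->; right; exists a.
  - by left; apply/tree_rootsP; left.
  - have [al|al] := boolP (long B Delta a).
      by left; apply/tree_rootsP; right; exists a; rewrite // !inE /= ha al.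
    by right; apply/imfsetP; exists a; rewrite // !inE /= ha al.
split.
- move=> x /imfsetP[a /=]; rewrite !inE /= => /andP[ha al] ->.
  exact: (short_pathsum hDelta hPi htheta hat0 hfw hT (ha : a \in Pi) al).
- by rewrite SE; apply: (tree_roots_tree hDelta hPi htheta hat0 hfw hT).
- by rewrite SE; apply: (tree_roots_edges hDelta hPi htheta hat0 hfw hT).
exists (node_map theta A); split=> //; split.
  rewrite SE; apply: (node_map_biject hDelta hPi htheta hat0 hfw hT) => // x.
  by rewrite inE nodeT.
move=> x y _ _ xy.
rewrite SE (node_map_adj hDelta hPi htheta hat0 hfw hT) //.
by rewrite /lines cartan_mul_eq0.
Qed.
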